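(* Let $G$ be a connected Lie subgroup of $(\mathbb{R}^*\times O(3))\ltimes \mathbb{R}^3$ with $\dim G\geq 2$. Then $G$ is conjugate (in $(\mathbb{R}^*\times O(3))\ltimes \mathbb{R}^3$) to one of the following Lie subgroups, where $a\in\mathbb{R}^*$ is a constant: $$\mathbb{R}^*_+\ltimes \mathbb{R}^{3},\quad (\mathbb{R}_+^*\times SO(3))\ltimes \mathbb{R}^{3},\quad SO(3)\ltimes \mathbb{R}^3,\quad \mathcal{N}_a \ltimes \mathbb{R}^{3},$$ $$\mathbb{R}^{3},\quad SO(2)\ltimes \mathbb{R}^3,\quad (\mathbb{R}_+^*\times SO(2))\ltimes \mathbb{R}^3,\quad \mathcal{S}\ltimes \mathscr{P},$$ $$SO(2)\ltimes \mathscr{P},\quad (\mathbb{R}_+^*\times SO(2))\ltimes \mathscr{P},\quad \mathbb{R}_+^*\ltimes \mathscr{P},\quad \mathcal{N}_a\ltimes \mathscr{P},$$ $$\mathscr{P},\quad SO(2)\times \mathscr{L},\quad (\mathbb{R}_+^*\times SO(2))\ltimes \mathscr{L},\quad \mathcal{N}_a\ltimes \mathscr{L},$$ $$\mathbb{R}_+^*\ltimes \mathscr{L},\quad \mathbb{R}_+^*\times SO(3),\quad SO(3),\quad \mathbb{R}_+^*\times SO(2).$$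
   Context: Here $\mathbb{R}^*=\mathbb{R}\setminus\{0\}$, and $(\mathbb{R}^*\times O(3))\ltimes\mathbb{R}^3$ has product $(\alpha,A,v)(\beta,B,w)=(\alpha\beta,AB,\alpha A(w)+v)$. Lie subgroups are not assumed to be closed. Let $\{e_1,e_2,e_3\}$ be the standard basis of $\mathbb{R}^3$ and $R_t=\begin{bmatrix}\cos t&\sin t&0\\-\sin t&\cos t&0\\0&0&1\end{bmatrix}$. Inside this group: $\mathbb{R}^3$, $\mathscr{P}=\mathbb{R}e_1\oplus\mathbb{R}e_2$ and $\mathscr{L}=\mathbb{R}e_3$ are groups of translations $(1,\mathrm{Id},v)$; $\mathbb{R}_+^*=\{(\alpha,\mathrm{Id},0):\alpha>0\}$; $SO(3)=\{(1,A,0):A\in SO(3)\}$; $SO(2)=\{(1,R_t,0):t\in\mathbb{R}\}$; $\mathcal{N}_a=\{(e^{at},R_t,0):t\in\mathbb{R}\}$ for $a\in\mathbb{R}^*$; $\mathcal{S}=\{(1,R_t,te_3):t\in\mathbb{R}\}$. Products and semi-direct products are the subgroups generated by the indicated factors. *)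

(* Defs.v *)
From HB Require Import structures.
From mathcomp Require Import all_boot all_order all_algebra.
From mathcomp Require Import all_classical all_reals all_analysis.

Set Implicit Arguments.
Unset Strict Implicit.
Unset Printing Implicit Defensive.

Import Order.TTheory GRing.Theory Num.Theory.
Import numFieldNormedType.Exports.

Local Open Scope classical_set_scope.
Local Open Scope ring_scope.

Section Smooth.
Context {R : realType} {V W : normedModType R}.

(* The class C^n, for open [U] : [f] is C^(n+1) iff it is differentiable and all
   its directional derivatives are C^n. *)
Fixpoint differentiable_upto (n : nat) (U : set V) (f : V -> W) : Prop :=
  match n with
  | 0 => forall x, U x -> {for x, continuous f}
  | n.+1 => (forall x, U x -> differentiable f x) /\
            (forall v : V, differentiable_upto n U ('D_v f))
  end.

Definition smooth_on (U : set V) (f : V -> W) : Prop :=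
  forall n, differentiable_upto n U f.

End Smooth.

(* Only the restriction of [chart_map] to [chart_dom], and that of [chart_inv]
   to the image of the chart, are meaningful. *)
Record chart (R : realType) (k : nat) (T : topologicalType) := Chart {
  chart_dom : set T;
  chart_map :> T -> 'rV[R]_k;
  chart_inv : 'rV[R]_k -> T;
  chart_dom_open : open chart_dom;
  chart_img_open : open (chart_map @` chart_dom);
  chart_mapK : forall p, chart_dom p -> chart_inv (chart_map p) = p;
  chart_map_continuous : {within chart_dom, continuous chart_map};
  chart_inv_continuous :
    {within chart_map @` chart_dom, continuous chart_inv}
}.

Definition chart_img R k T (c : @chart R k T) : set 'rV[R]_k :=
  c @` chart_dom c.

Definition smooth_atlas R k T (A : set (@chart R k T)) : Prop :=
  (forall p, exists2 c, A c & chart_dom c p) /\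
  (forall c d, A c -> A d ->
     smooth_on (c @` (chart_dom c `&` chart_dom d)) (d \o chart_inv c)).

HB.mixin Record isLieGroup (R : realType) (k : nat) T
    of Topological T & Group T := {
  lie_atlas : set (chart R k T);
  lie_atlasP : smooth_atlas lie_atlas;
  lie_hausdorff : hausdorff_space T;
  lie_second_countable : @second_countable T;
  lie_mul_continuous : continuous (fun p : T * T => (p.1 * p.2)%g);
  lie_inv_continuous : continuous (fun p : T => p^-1%g);
  lie_mul_smooth : forall c d e : chart R k T,
    lie_atlas c -> lie_atlas d -> lie_atlas e ->
    smooth_on
      [set z : 'rV[R]_k * 'rV[R]_k |
        [/\ chart_img c z.1, chart_img d z.2 &
            chart_dom e (chart_inv c z.1 * chart_inv d z.2)%g]]
      (fun z => e (chart_inv c z.1 * chart_inv d z.2)%g);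
  lie_inv_smooth : forall c d : chart R k T,
    lie_atlas c -> lie_atlas d ->
    smooth_on
      [set x | chart_img c x /\ chart_dom d (chart_inv c x)^-1%g]
      (fun x => d (chart_inv c x)^-1%g)
}.

#[short(type="lieGroupType")]
HB.structure Definition LieGroup (R : realType) (k : nat) :=
  {T of isLieGroup R k T & Topological T & Group T}.

Section Similarity.
Context {R : realType}.

Definition is_sim : pred (R * 'M[R]_3 * 'cV[R]_3) :=
  fun x => (x.1.1 != 0) && (x.1.2 *m x.1.2^T == 1%:M).

(* The group (R^* x O(3)) |x R^3 : [(alpha, A, v)] acts on R^3 as
   [w |-> alpha *: A *m w + v]. *)
Record sim := Sim {
  sim_val :> R * 'M[R]_3 * 'cV[R]_3;
  _ : is_sim sim_val
}.

HB.instance Definition _ := [isSub for sim_val].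
HB.instance Definition _ := [Choice of sim by <:].

Implicit Types x y z : sim.

Lemma is_sim_one : is_sim (1, 1%:M, 0).
Proof. by rewrite /is_sim /= oner_neq0 trmx1 mul1mx eqxx. Qed.

Lemma sim_scale_neq0 x : (val x).1.1 != 0.
Proof. by have /andP[] := valP x. Qed.

Lemma sim_orthor x : (val x).1.2 *m (val x).1.2^T = 1%:M.
Proof. by have /andP[_ /eqP] := valP x. Qed.

Lemma sim_orthol x : (val x).1.2^T *m (val x).1.2 = 1%:M.
Proof. exact: mulmx1C (sim_orthor x). Qed.

Lemma is_sim_mul x y :
  is_sim ((val x).1.1 * (val y).1.1, (val x).1.2 *m (val y).1.2,
          (val x).1.1 *: ((val x).1.2 *m (val y).2) + (val x).2).
Proof.
rewrite /is_sim /= mulf_neq0 ?sim_scale_neq0 //= trmx_mul mulmxA.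
by rewrite -(mulmxA _ _ (val y).1.2^T) sim_orthor mulmx1 sim_orthor.
Qed.

Lemma is_sim_inv x :
  is_sim ((val x).1.1^-1, (val x).1.2^T,
          - ((val x).1.1^-1 *: ((val x).1.2^T *m (val x).2))).
Proof. by rewrite /is_sim /= invr_neq0 ?sim_scale_neq0 //= trmxK sim_orthol. Qed.

Definition sim_one := Sim is_sim_one.
Definition sim_mul x y := Sim (is_sim_mul x y).
Definition sim_inv x := Sim (is_sim_inv x).

Fact sim_mulA : associative sim_mul.
Proof.
move=> x y z; apply: val_inj => /=.
by rewrite mulrA !mulmxA mulmxDr scalerDr -scalemxAr scalerA addrA mulmxA.
Qed.

Fact sim_mul1 : left_id sim_one sim_mul.
Proof.
by case=> [[[a A] v] ?]; apply: val_inj; rewrite /= mul1r !mul1mx scale1r addr0.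
Qed.

Fact sim_mulr1 : right_id sim_one sim_mul.
Proof.
case=> [[[a A] v] ?]; apply: val_inj.
by rewrite /= mulr1 mulmx1 mulmx0 scaler0 add0r.
Qed.

Fact sim_mulV : left_inverse sim_one sim_inv sim_mul.
Proof.
move=> x; apply: val_inj => /=.
by rewrite mulVf ?sim_scale_neq0 // sim_orthol addrN.
Qed.

Fact sim_mulrV : right_inverse sim_one sim_inv sim_mul.
Proof.
move=> x; apply: val_inj => /=.
rewrite divff ?sim_scale_neq0 // sim_orthor mulmxN scalerN -scalemxAr scalerA.
by rewrite mulmxA sim_orthor mul1mx divff ?sim_scale_neq0 // scale1r addNr.
Qed.

HB.instance Definition _ :=
  isGroup.Build sim sim_mulA sim_mul1 sim_mulr1 sim_mulV sim_mulrV.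

End Similarity.

Arguments sim R : clear implicits.

Section Subgroups.
Context {R : realType}.
Implicit Types (G K A : set (sim R)) (a t : R).

(* [G] is the image of a connected Lie group of dimension [k] by an injective
   homomorphism which is a smooth immersion; [G] need not be closed, and its
   topology may be finer than the induced one.  Smoothness and immersivity are
   tested in the vector space [R * 'M_3 * 'cV_3], of which the group of
   similarities is an embedded submanifold. *)
Definition connected_lie_subgroup (k : nat) G : Prop :=
  exists (L : lieGroupType R k) (f : L -> sim R),
    [/\ connected [set: L], {morph f : p q / (p * q)%g}, injective f,
        range f = G &
        forall c : chart R k L, lie_atlas c ->
          smooth_on (chart_img c) (sim_val \o f \o chart_inv c) /\
          (forall x, chart_img c x ->
             injective ('d (sim_val \o f \o chart_inv c) x))].

Definition is_subgroup G : Prop :=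
  G 1%g /\ (forall x y, G x -> G y -> G (x / y)%g).

Definition generated A : set (sim R) := smallest is_subgroup A.

Definition conjugate_to G K : Prop :=
  exists g : sim R, K = [set (x ^ g)%g | x in G].

Definition basis_vec (i : 'I_3) : 'cV[R]_3 := delta_mx i 0.

Definition rot t : 'M[R]_3 := \matrix_(i, j)
  nth 0 (nth [::] [:: [:: cos t;     sin t; 0];
                      [:: - sin t;   cos t; 0];
                      [:: 0;         0;     1]] i) j.

Definition translations : set (sim R) :=
  [set x | exists v, val x = (1, 1%:M, v)].

Definition plane_translations : set (sim R) :=
  [set x | exists s t, val x =
    (1, 1%:M, s *: basis_vec 0 + t *: basis_vec 1)].

Definition line_translations : set (sim R) :=
  [set x | exists t, val x = (1, 1%:M, t *: basis_vec 2)].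

Definition pos_homotheties : set (sim R) :=
  [set x | exists2 a, 0 < a & val x = (a, 1%:M, 0)].

Definition SO3 : set (sim R) :=
  [set x | exists2 A, A *m A^T = 1%:M /\ \det A = 1 & val x = (1, A, 0)].

Definition SO2 : set (sim R) :=
  [set x | exists t, val x = (1, rot t, 0)].

Definition spiral a : set (sim R) :=
  [set x | exists t, val x = (expR (a * t), rot t, 0)].

Definition screw : set (sim R) :=
  [set x | exists t, val x = (1, rot t, t *: basis_vec 2)].

End Subgroups.

(* Main.v *)
From mathcomp Require Import all_boot all_order all_algebra.
From mathcomp Require Import all_classical all_reals all_analysis.
From mathcomp Require Import ring lra.
Require Import Defs.

Set Implicit Arguments.
Unset Strict Implicit.
Unset Printing Implicit Defensive.

Import Order.TTheory GRing.Theory Num.Theory.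
Import numFieldNormedType.Exports.

Local Open Scope classical_set_scope.
Local Open Scope ring_scope.

(* A connected Lie subgroup G, the image of L, is handled through the set g of
   velocities at 0 of curves N in G with N(0) = 1 that are continuous in L at 0.
   Two facts replace the general theory of Lie groups.

   Exponential: if X is in g then the one-parameter group e with velocity X lies
   in G, as e(t) is the limit of gamma(t/n)^n and these powers stay in a compact
   neighbourhood of 1 in L.  Finite differences Ad(e(t)) Y - Y then play the part
   of the Lie brackets.

   Invariants: a function on the similarity group whose derivatives along all
   left-invariant directions of g vanish is constant on G.

   Normalising g by conjugations gives one of the standard algebras; the
   exponential shows that G contains the corresponding standard group, and
   suitable invariants (the scale, the image of the axis, the translation part,
   the angle compared with the scale or with the height) show that it is not
   larger. *)

(** The injection of [L] need not be a homeomorphism onto [G], so a curve that is smooth among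
    similarities can be discontinuous in [L]; this is why continuity in [L] is demanded of the
    curves that define [g]. About [g] one retains only its stability under sums, scalars and [Ad x]
    for [x] in [G], and two independent elements. A difference stands for a bracket because the
    conjugating element is chosen to make it exact: a translation at time 1, a homothety of ratio 2.
    Rotations give no exact bracket, and half and quarter turns are used instead. The invariants
    bound [G] from above where one would otherwise compare dimensions. The obstacle in normalising
    is that an infinitesimal similarity may rotate, dilate and translate along its axis. A dilation
    has a fixed point, so recentring leaves dilation rate times pitch equal to 0, and under this
    condition the one-parameter group is explicit. The case with no rotation at all is treated
    apart. *)

Lemma mxDE (K : nmodType) m n (A B : 'M[K]_(m, n)) i j :
  (A + B) i j = A i j + B i j.
Proof. by rewrite mxE. Qed.

Lemma mxZE (K : pzRingType) m n (a : K) (A : 'M[K]_(m, n)) i j :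
  (a *: A) i j = a * A i j.
Proof. by rewrite mxE. Qed.

(** * Velocities of curves of similarities *)

Section Velocity.
Context {R : realType}.
Local Notation V := (R * 'M[R]_3 * 'cV[R]_3)%type.
Implicit Types (M N : R -> sim R) (X Y D E : V) (x y : sim R).

Lemma sim_inj x y : val x = val y -> x = y.
Proof. exact: val_inj. Qed.

Lemma val_simM x y : val (x * y)%g =
  ((val x).1.1 * (val y).1.1, (val x).1.2 *m (val y).1.2,
   (val x).1.1 *: ((val x).1.2 *m (val y).2) + (val x).2).
Proof. by []. Qed.

Lemma val_sim1 : val (1%g : sim R) = (1, 1%:M, 0).
Proof. by []. Qed.

Lemma val_simV x : val x^-1%g =
  ((val x).1.1^-1, (val x).1.2^T,
   - ((val x).1.1^-1 *: ((val x).1.2^T *m (val x).2))).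
Proof. by []. Qed.

(** Entrywise real derivatives at the single point 0: the product rules for real functions then
    suffice, and no smooth structure on the group of similarities has to be set up. *)
Definition velocity N D : Prop :=
  [/\ is_derive (0 : R) (1 : R) (fun s => (val (N s)).1.1) D.1.1,
      forall i j, is_derive (0 : R) (1 : R) (fun s => (val (N s)).1.2 i j) (D.1.2 i j) &
      forall i, is_derive (0 : R) (1 : R) (fun s => (val (N s)).2 i 0) (D.2 i 0)].

Lemma velocity_cst x : velocity (fun=> x) 0.
Proof. by split=> [|i j|i] /=; rewrite ?mxE; exact: is_derive_cst. Qed.

Lemma is_derive_mulmx m n p (A : R -> 'M[R]_(m, n)) (B : R -> 'M[R]_(n, p))
    (t : R) (A' : 'M[R]_(m, n)) (B' : 'M[R]_(n, p)) i j :
    (forall i j, is_derive t (1 : R) (fun s => A s i j) (A' i j)) ->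
    (forall i j, is_derive t (1 : R) (fun s => B s i j) (B' i j)) ->
  is_derive t (1 : R) (fun s => (A s *m B s) i j) ((A' *m B t + A t *m B') i j).
Proof.
move=> dA dB.
have -> : (fun s => (A s *m B s) i j) =
    \sum_(k < n) ((fun s => A s i k) * (fun s => B s k j)).
  by apply/funext => s; rewrite mxE fct_sumE.
apply: is_derive_eq.
rewrite !mxE -big_split /=; apply: eq_bigr => k _.
by rewrite /GRing.scale /= addrC [_ * B' _ _]mulrC [B t k j * _]mulrC [B' k j * _]mulrC.
Qed.

Lemma velocityM M N D E : velocity M D -> velocity N E ->
  velocity (fun s => M s * N s)%g
    (D.1.1 * (val (N 0)).1.1 + (val (M 0)).1.1 * E.1.1,
     D.1.2 *m (val (N 0)).1.2 + (val (M 0)).1.2 *m E.1.2,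
     D.1.1 *: ((val (M 0)).1.2 *m (val (N 0)).2) +
     (val (M 0)).1.1 *: (D.1.2 *m (val (N 0)).2 + (val (M 0)).1.2 *m E.2) + D.2).
Proof.
move=> [Ma MA Mv] [Na NA Nv]; split => /=.
- by apply: is_derive_eq (is_deriveM Ma Na) _; rewrite /GRing.scale /=; ring.
- by move=> i j; apply: is_derive_mulmx.
move=> i.
have H : is_derive (0 : R) (1 : R) (fun s => ((val (M s)).1.2 *m (val (N s)).2) i 0)
    ((D.1.2 *m (val (N 0)).2 + (val (M 0)).1.2 *m E.2) i 0).
  by apply: is_derive_mulmx => // k l; rewrite !ord1.
have Hi := is_deriveD (is_deriveM Ma H) (Mv i).
have e t : ((val (M t)).1.1 *: ((val (M t)).1.2 *m (val (N t)).2)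
    + (val (M t)).2) i 0 =
   (val (M t)).1.1 * ((val (M t)).1.2 *m (val (N t)).2) i 0 + (val (M t)).2 i 0.
  by rewrite !mxDE !mxZE.
under eq_fun do rewrite e.
apply: is_derive_eq Hi _; rewrite /GRing.scale /=.
rewrite !mxDE !mxZE !mxDE.
ring.
Qed.

Definition tangent N X : Prop := N 0 = 1%g /\ velocity N X.

Lemma tangentM M N X Y : tangent M X -> tangent N Y ->
  tangent (fun s => M s * N s)%g (X + Y).
Proof.
move=> [M0 dM] [N0 dN]; split; first by rewrite M0 N0 mulg1.
have := velocityM dM dN; rewrite M0 N0 val_sim1 /=.
rewrite !mul1r !mulr1 !mulmx1 !mul1mx !mulmx0 scaler0 scale1r !add0r.
by rewrite [Y.2 + _]addrC.
Qed.

Lemma tangentZ N X c : tangent N X -> tangent (fun s => N (c * s)) (c *: X).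
Proof.
move=> [N0 [Na NA Nv]]; split; first by rewrite mulr0.
have sc (h : R -> R) d : is_derive (0 : R) (1 : R) h d ->
    is_derive (0 : R) (1 : R) (fun s => h (c * s)) (c * d).
  move=> dh; have dc : is_derive (0 : R) (1 : R) (fun s : R => c * s) c.
    by apply: is_derive_eq (is_deriveZ c (is_derive_id _ _)) _; rewrite /GRing.scale /= mulr1.
  have dh' : is_derive (c * 0) (1 : R) h d by rewrite mulr0.
  by apply: is_derive_eq (is_derive1_comp dh' dc) _; rewrite mulrC.
split => /= [|i j|i]; first exact: sc.
  by rewrite mxE; apply: (sc (fun s => (val (N s)).1.2 i j)).
by rewrite mxE; apply: (sc (fun s => (val (N s)).2 i 0)).
Qed.

Definition left_trans x X : V :=
  ((val x).1.1 * X.1.1, (val x).1.2 *m X.1.2, (val x).1.1 *: ((val x).1.2 *m X.2)).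

Lemma velocity_left x N D : velocity N D ->
  velocity (fun s => x * N s)%g (left_trans x D).
Proof.
move=> dN; have := velocityM (velocity_cst x) dN.
by rewrite /= !mul0r !mul0mx !scale0r !add0r !addr0.
Qed.

(** The adjoint action, that is the velocity at 0 of [x * N s * x^-1]. The two subtracted terms are
    the linear part of the infinitesimal similarity, rotated by [x], evaluated at the translation
    part of [x]. *)
Definition Ad x X : V :=
  (X.1.1, (val x).1.2 *m X.1.2 *m (val x).1.2^T,
   (val x).1.1 *: ((val x).1.2 *m X.2) - X.1.1 *: (val x).2
   - (val x).1.2 *m X.1.2 *m (val x).1.2^T *m (val x).2).

Lemma tangent_conj x N X : tangent N X ->
  tangent (fun s => x * N s * x^-1)%g (Ad x X).
Proof.
move=> dN; have [N0 _] := dN.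
split; first by rewrite N0 mulg1 mulgV.
have := velocityM (velocity_left x dN.2) (velocity_cst x^-1%g).
rewrite N0 mulg1 val_simV /= /Ad.
congr (velocity _ (_, _, _)).
- by rewrite mulr0 addr0 mulrAC divff ?sim_scale_neq0 // mul1r.
- by rewrite mulmx0 addr0.
rewrite mulmx0 addr0 !mulmxN !scalerN -!scalemxAr !scalerA.
rewrite divff ?sim_scale_neq0 // scale1r mulrAC divff ?sim_scale_neq0 // mul1r.
by rewrite mulmxA sim_orthor mul1mx !mulmxA addrC addrA.
Qed.

(** Differentiate [A *m A^T = 1] at the identity. *)
Lemma tangent_skew N X : tangent N X -> X.1.2^T = - X.1.2.
Proof.
move=> [N0 [_ NA _]]; apply/matrixP => i j.
have tA k l : is_derive (0 : R) (1 : R) (fun s => (val (N s)).1.2^T k l) (X.1.2^T k l).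
  by rewrite mxE; under eq_fun do rewrite mxE; exact: NA.
have H := is_derive_mulmx i j NA tA.
have [_ e2] := is_derive_cst ((1%:M : 'M[R]_3) i j) (0 : R) (1 : R).
move: H; under eq_fun do rewrite sim_orthor.
move=> [_]; rewrite N0 val_sim1 /= trmx1 mulmx1 mul1mx [LHS]e2.
by rewrite !mxE => /esym/eqP; rewrite addrC addr_eq0 => /eqP ->.
Qed.

End Velocity.

(** * Powers of similarities near the identity *)

Section Estimates.
Context {R : realType}.
Local Notation V := (R * 'M[R]_3 * 'cV[R]_3)%type.
Implicit Types (x y z : sim R) (X : V).

Lemma mx_norm_leP m n (A : 'M[R]_(m, n)) (r : R) : 0 <= r ->
  (`|A| <= r) <-> (forall i j, `|A i j| <= r).
Proof.
move=> r0; rewrite /Num.norm /= mx_normrE; split => [/bigmax_leP[_ h] i j|h].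
  exact: (h (i, j)).
by apply/bigmax_leP; split => // -[i j] _; exact: h.
Qed.

Lemma norm_entries_leP X (r : R) : 0 <= r ->
  (`|X| <= r) <->
  [/\ `|X.1.1| <= r, forall i j, `|X.1.2 i j| <= r & forall i, `|X.2 i 0| <= r].
Proof.
move=> r0; case: X => [[a A] v] /=.
rewrite !prod_normE /= !ge_max; split.
  move=> /andP[/andP[-> /mx_norm_leP hA] /mx_norm_leP hv].
  by split => // [i j|i]; [exact: hA|exact: hv].
move=> [-> hA hv]; apply/andP; split; [apply/andP; split => //|].
  exact/mx_norm_leP.
by apply/mx_norm_leP => // i j; rewrite ord1.
Qed.

Lemma norm_entries X :
  [/\ `|X.1.1| <= `|X|, forall i j, `|X.1.2 i j| <= `|X| & forall i, `|X.2 i 0| <= `|X|].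
Proof. exact/norm_entries_leP. Qed.

Lemma norm_mulmx3_le m n (A : 'M[R]_(m, 3)) (B : 'M[R]_(3, n)) a b i j :
  (forall k, `|A i k| <= a) -> (forall k, `|B k j| <= b) ->
  `|(A *m B) i j| <= 3 * a * b.
Proof.
move=> hA hB; rewrite mxE (le_trans (ler_norm_sum _ _ _))//.
apply: (@le_trans _ _ (\sum_(k < 3) a * b)).
  by apply: ler_sum => k _; rewrite normrM ler_pM.
by rewrite sumr_const card_ord -mulrA mulr_natl.
Qed.

Lemma near_one_bounded x : `|val x - val (1%g : sim R)| <= 1 ->
  `|(val x).1.1| <= 2 /\ forall i j, `|(val x).1.2 i j| <= 2.
Proof.
move=> x1; have [h1 h2 _] := norm_entries (val x - val (1%g : sim R)).
move: h1 h2 => /= h1 h2; split.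
  by have := ler_normD ((val x).1.1 - 1) 1; rewrite subrK normr1; lra.
move=> i j; have := h2 i j; rewrite !mxE => {}h2.
have := ler_normD ((val x).1.2 i j - (i == j)%:R) (i == j)%:R; rewrite subrK.
have : `|(i == j)%:R : R| <= 1 by case: eqP => _; rewrite ?normr1 ?normr0 ?ler01.
lra.
Qed.

(** Right multiplication is iterated when powers are compared, so its Lipschitz constant has to be 1
    up to the distance from [y] to 1. In the translation part the excess is 6 + 6 = 12: scales and
    entries are at most 2, and a product of matrices brings a factor 3. *)
Lemma dist_simMr x x' y :
  `|val x - val (1%g : sim R)| <= 1 -> `|val x' - val (1%g : sim R)| <= 1 ->
  `|val (x * y)%g - val (x' * y)%g| <=
    (1 + 12 * `|val y - val (1%g : sim R)|) * `|val x - val x'|.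
Proof.
move=> /near_one_bounded[a2 A2] /near_one_bounded[a2' A2'].
set d := `|val x - val x'|; set e := `|val y - _|.
have [dx dX dv] := norm_entries (val x - val x').
have [ex eX ev] := norm_entries (val y - val (1%g : sim R)).
move: dx dX dv ex eX ev; rewrite -/d -/e /= => dx dX dv ex eX ev.
have d0 : 0 <= d by rewrite normr_ge0.
have e0 : 0 <= e by rewrite normr_ge0.
apply/norm_entries_leP; first by rewrite mulr_ge0 // addr_ge0 // mulr_ge0.
split=> /=.
- rewrite -mulrBl -[(val y).1.1](subrK 1) mulrDr mulr1.
  rewrite (le_trans (ler_normD _ _))// normrM.
  have : `|(val x).1.1 - (val x').1.1| * `|(val y).1.1 - 1| <= d * e by exact: ler_pM.
  nra.
- move=> i j; rewrite -mulmxBl -[(val y).1.2](subrK 1%:M) mulmxDr mulmx1 mxDE.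
  rewrite (le_trans (ler_normD _ _))//.
  have := @norm_mulmx3_le _ _ ((val x).1.2 - (val x').1.2) ((val y).1.2 - 1%:M) d e i j
    (dX i) (eX^~ j).
  have := dX i j; nra.
move=> i.
have -> : (val x).1.1 *: ((val x).1.2 *m (val y).2) + (val x).2 -
    ((val x').1.1 *: ((val x').1.2 *m (val y).2) + (val x').2) =
  ((val x).1.1 - (val x').1.1) *: ((val x).1.2 *m (val y).2) +
  (val x').1.1 *: (((val x).1.2 - (val x').1.2) *m (val y).2) + ((val x).2 - (val x').2).
  by rewrite mulmxBl scalerBl scalerBr subrKA opprD addrACA.
have ev' k : `|(val y).2 k 0| <= e by have := ev k; rewrite subr0.
have h1 := @norm_mulmx3_le _ _ (val x).1.2 (val y).2 2 e i 0 (A2 i) ev'.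
have h2 := @norm_mulmx3_le _ _ ((val x).1.2 - (val x').1.2) (val y).2 d e i 0 (dX i) ev'.
rewrite mxDE (mxDE (_ *: _)) !mxZE (le_trans (ler_normD _ _))//.
have := dv i; have := ler_normD (((val x).1.1 - (val x').1.1) * ((val x).1.2 *m (val y).2) i 0)
  ((val x').1.1 * (((val x).1.2 - (val x').1.2) *m (val y).2) i 0).
rewrite !normrM.
have := ler_pM (normr_ge0 _) (normr_ge0 _) dx h1.
have := ler_pM (normr_ge0 _) (normr_ge0 _) a2' h2.
nra.
Qed.

(** A crude constant is enough, as left multiplication is applied once per step: 12 is the bound 2
    of the scale, times 3, times the bound 2 of the entries. *)
Lemma dist_simMl x y y' : `|val x - val (1%g : sim R)| <= 1 ->
  `|val (x * y)%g - val (x * y')%g| <= 12 * `|val y - val y'|.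
Proof.
move=> /near_one_bounded[a2 A2].
set d := `|val y - val y'|.
have [dx dX dv] := norm_entries (val y - val y').
move: dx dX dv; rewrite -/d /= => dx dX dv.
have d0 : 0 <= d by rewrite normr_ge0.
apply/norm_entries_leP; first by rewrite mulr_ge0.
split=> /=.
- rewrite -mulrBr normrM.
  by have := ler_pM (normr_ge0 _) (normr_ge0 _) a2 dx; lra.
- move=> i j; rewrite -mulmxBr.
  by have := @norm_mulmx3_le _ _ (val x).1.2 ((val y).1.2 - (val y').1.2) 2 d i j (A2 i) (dX^~ j); lra.
move=> i; rewrite opprD addrACA subrr addr0 -scalerBr -mulmxBr mxZE normrM.
have := @norm_mulmx3_le _ _ (val x).1.2 ((val y).2 - (val y').2) 2 d i 0 (A2 i) dv.
move=> /(ler_pM (normr_ge0 _) (normr_ge0 _) a2); lra.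
Qed.

Lemma dist_simX x n (m := 12 * `|val x - val (1%g : sim R)|) :
  n%:R * m <= 1 -> `|val (x ^+ n)%g - val (1%g : sim R)| <= n%:R * m.
Proof.
have m0 : 0 <= m by rewrite mulr_ge0.
elim: n => [_|n IHn]; first by rewrite expg0 subrr normr0 mul0r.
rewrite -natr1 mulrDl mul1r => h.
have n1 : n%:R * m <= 1 by lra.
have {}IHn := IHn n1.
rewrite expgSr.
have x1 : `|val (x ^+ n)%g - val (1%g : sim R)| <= 1 by exact: le_trans IHn n1.
have := dist_simMl x 1%g x1; rewrite mulg1 -/m => h1.
have := ler_normD (val (x ^+ n * x)%g - val (x ^+ n)%g) (val (x ^+ n)%g - val (1%g : sim R)).
by rewrite addrA subrK; lra.
Qed.

(** Telescoping [x^(n+1) - y^(n+1) = x^n (x - y) + (x^n - y^n) y]: the first term costs 12, and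
    since [n%:R * k <= 1/2] the excess over 1 of the right Lipschitz constant costs at most another
    12, hence 24 per step. *)
Lemma dist_simXX x y n (m := 12 * `|val x - val (1%g : sim R)|)
  (k := 12 * `|val y - val (1%g : sim R)|) :
  n%:R * m <= 1 -> n%:R * k <= 1/2 ->
  `|val (x ^+ n)%g - val (y ^+ n)%g| <= 24 * n%:R * `|val x - val y|.
Proof.
have m0 : 0 <= m by rewrite mulr_ge0.
have k0 : 0 <= k by rewrite mulr_ge0.
have d0 := normr_ge0 (val x - val y).
elim: n => [_ _|n IHn]; first by rewrite !expg0 subrr normr0 mulr0 mul0r.
rewrite -natr1 !mulrDl !mul1r => h h'.
have n1 : n%:R * m <= 1 by lra.
have n2 : n%:R * k <= 1/2 by lra.
have {}IHn := IHn n1 n2.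
rewrite !expgSr.
have x1 : `|val (x ^+ n)%g - val (1%g : sim R)| <= 1 by apply: le_trans (dist_simX n1) n1.
have y1 : `|val (y ^+ n)%g - val (1%g : sim R)| <= 1.
  have n2' : n%:R * k <= 1 by lra.
  exact: le_trans (dist_simX n2') n2'.
have h1 := dist_simMl x y x1.
have := dist_simMr y x1 y1; rewrite -/k => h2.
have := ler_normD (val (x ^+ n * x)%g - val (x ^+ n * y)%g) (val (x ^+ n * y)%g - val (y ^+ n * y)%g).
rewrite addrA subrK => h3.
have : k * `|val (x ^+ n)%g - val (y ^+ n)%g| <= k * (24 * n%:R * `|val x - val y|).
  exact: ler_wpM2l.
have : n%:R * k * (24 * `|val x - val y|) <= 1/2 * (24 * `|val x - val y|).
  by apply: ler_wpM2r => //; rewrite mulr_ge0.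
lra.
Qed.

End Estimates.

Section TangentEstimate.
Context {R : realType}.
Local Notation V := (R * 'M[R]_3 * 'cV[R]_3)%type.
Implicit Types (N e : R -> sim R) (X : V).

Lemma is_derive0_le (h : R -> R) (d eps : R) : is_derive (0 : R) (1 : R) h d -> 0 < eps ->
  \forall s \near (0 : R), `|h s - h 0 - s * d| <= eps * `|s|.
Proof.
move=> [dh dhE] eps0.
have H : (fun s => s^-1 *: (h (s *: 1 + 0) - h 0)) @ 0^' --> d.
  by rewrite -dhE; exact: dh.
have /cvgrPdist_le/(_ eps eps0) := H.
rewrite /dnbhs /within /prop_near1 /= => H'.
near=> s.
have [->|s0] := eqVneq s 0; first by rewrite subrr mul0r subr0 normr0 mulr0.
have : `|d - s^-1 *: (h (s *: 1 + 0) - h 0)| <= eps.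
  by move: s0; near: s; exact: H'.
rewrite /GRing.scale /=. rewrite mulr1 addr0 => h1.
have -> : h s - h 0 - s * d = - (s * (d - s^-1 * (h s - h 0))) by field.
by rewrite normrN normrM mulrC ler_wpM2r.
Unshelve. all: by end_near. Qed.

Lemma tangent_le N X (eps : R) : tangent N X -> 0 < eps ->
  \forall s \near (0 : R), `|val (N s) - val (1%g : sim R) - s *: X| <= eps * `|s|.
Proof.
move=> [N0 [Na NA Nv]] eps0.
have := is_derive0_le Na eps0; rewrite N0 /= => {}Na.
have {}NA : \forall s \near (0 : R), forall ij : 'I_3 * 'I_3,
    `|(val (N s)).1.2 ij.1 ij.2 - (1%:M : 'M[R]_3) ij.1 ij.2 - s * X.1.2 ij.1 ij.2| <= eps * `|s|.
  have H (ij : 'I_3 * 'I_3) := is_derive0_le (NA ij.1 ij.2) eps0.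
  have := filter_forall _ H; rewrite N0; exact.
have {}Nv : \forall s \near (0 : R), forall i : 'I_3,
    `|(val (N s)).2 i 0 - (0 : 'cV[R]_3) i 0 - s * X.2 i 0| <= eps * `|s|.
  have H i := is_derive0_le (Nv i) eps0.
  have := filter_forall _ H; rewrite N0; exact.
near=> s; apply/norm_entries_leP; first by rewrite mulr_ge0 // ltW.
split => /= [|i j|i]; first by near: s.
  have : forall ij : 'I_3 * 'I_3, `|(val (N s)).1.2 ij.1 ij.2 - (1%:M : 'M[R]_3) ij.1 ij.2 -
    s * X.1.2 ij.1 ij.2| <= eps * `|s| by near: s.
  by move=> /(_ (i, j)); rewrite !mxE.
have : forall i : 'I_3, `|(val (N s)).2 i 0 - (0 : 'cV[R]_3) i 0 - s * X.2 i 0| <= eps * `|s|.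
  by near: s.
by move=> /(_ i); rewrite !mxE.
Unshelve. all: by end_near. Qed.

Lemma tangent_lipschitz N X : tangent N X ->
  \forall s \near (0 : R), `|val (N s) - val (1%g : sim R)| <= (1 + `|X|) * `|s|.
Proof.
move=> dN; near=> s.
have h1 : `|val (N s) - val (1%g : sim R) - s *: X| <= 1 * `|s|.
  by near: s; exact: tangent_le.
have := ler_normD (val (N s) - val (1%g : sim R) - s *: X) (s *: X).
by rewrite subrK normrZ; lra.
Unshelve. all: by end_near. Qed.

(** Both curves have the same first-order expansion. At [s = t / n] this o(s) stays negligible after
    passing to the n-th powers, which multiplies it by 24 n. *)
Lemma tangent_dist M N X (eps : R) : tangent M X -> tangent N X -> 0 < eps ->
  \forall s \near (0 : R), `|val (M s) - val (N s)| <= eps * `|s|.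
Proof.
move=> dM dN eps0; have e2 : 0 < eps / 2 by rewrite divr_gt0.
near=> s.
have h1 : `|val (M s) - val (1%g : sim R) - s *: X| <= eps / 2 * `|s|.
  by near: s; exact: tangent_le.
have h2 : `|val (N s) - val (1%g : sim R) - s *: X| <= eps / 2 * `|s|.
  by near: s; exact: tangent_le.
have := ler_normB (val (M s) - val (1%g : sim R) - s *: X) (val (N s) - val (1%g : sim R) - s *: X).
rewrite opprB addrA subrK opprB addrA subrK; lra.
Unshelve. all: by end_near. Qed.

Definition one_param e : Prop := forall s t, e (s + t) = (e s * e t)%g.

Lemma one_paramX e (t : R) n : one_param e -> e (t *+ n.+1) = (e t ^+ n.+1)%g.
Proof.
move=> he; elim: n => [|n IHn]; first by rewrite expg1 mulr1n.
by rewrite mulrS he IHn -expgS.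
Qed.

End TangentEstimate.

Lemma within_open_continuous_at (T U : topologicalType) (A : set T) (g : T -> U) x :
  open A -> {within A, continuous g} -> A x -> {for x, continuous g}.
Proof.
move=> oA; rewrite continuous_open_subspace // => cg Ax.
by apply: cg; rewrite inE.
Qed.

(** * One-parameter groups inside the image of a Lie group *)

Section LieGroup.
Context {R : realType} {k : nat} (L : lieGroupType R k) (f : L -> sim R).
Local Notation V := (R * 'M[R]_3 * 'cV[R]_3)%type.
Hypotheses (Lconn : connected [set: L]) (fM : {morph f : p q / (p * q)%g}).
Hypotheses (finj : injective f).
Hypotheses (fsmooth : forall c : chart R k L, lie_atlas c ->
  smooth_on (chart_img c) (sim_val \o f \o chart_inv c)).

Lemma lie_morph1 : f 1%g = 1%g.
Proof. by apply: (mulgI (f 1%g)); rewrite -fM !mulg1. Qed.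

Lemma lie_morphV p : f p^-1%g = (f p)^-1%g.
Proof. by apply: (mulgI (f p)); rewrite -fM !mulgV lie_morph1. Qed.

Lemma lie_morphX p n : f (p ^+ n)%g = (f p ^+ n)%g.
Proof. by elim: n => [|n IHn]; rewrite ?expg0 ?lie_morph1 // !expgS fM IHn. Qed.

Lemma chart_map_continuous_at (c : chart R k L) p : chart_dom c p ->
  {for p, continuous c}.
Proof.
move=> cp.
exact: within_open_continuous_at (chart_dom_open c) (@chart_map_continuous _ _ _ c) cp.
Qed.

Lemma chart_inv_continuous_at (c : chart R k L) x : chart_img c x ->
  {for x, continuous (chart_inv c)}.
Proof.
move=> cp.
exact: (@within_open_continuous_at _ _ (chart_img c) (chart_inv c) x
  (@chart_img_open _ _ _ c) (@chart_inv_continuous _ _ _ c) cp).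
Qed.

Lemma chart_img_map (c : chart R k L) p : chart_dom c p -> chart_img c (c p).
Proof. by move=> cp; exists p. Qed.

Lemma lie_morph_continuous : continuous (fun p => val (f p)).
Proof.
move=> p; have [hA _] := @lie_atlasP _ _ L; have [c Ac cp] := hA p.
have cx := fsmooth Ac 0%N _ (chart_img_map cp).
have cc := chart_map_continuous_at cp.
have H : {for p, continuous ((sim_val \o f \o chart_inv c) \o c)}.
  exact: continuous_comp.
have fE : {near p, (sim_val \o f \o chart_inv c) \o c =1 (fun p => val (f p))}.
  have : nbhs p (chart_dom c) by apply: open_nbhs_nbhs; split=> //; exact: chart_dom_open.
  by apply: filterS => q cq /=; rewrite chart_mapK.
apply: cvg_trans (near_eq_cvg fE) _.
by move: H; rewrite /prop_for /continuous_at /= chart_mapK.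
Qed.

(** The inverse of a chart is continuous on the chart image, so it carries a closed ball contained
    there to a compact set. *)
Lemma lie_compact_nbhs : exists2 C : set L, compact C & nbhs 1%g C.
Proof.
have [hA _] := @lie_atlasP _ _ L; have [c Ac c1] := hA 1%g.
have nc : nbhs (c 1%g) (chart_img c).
  apply: open_nbhs_nbhs; split; [exact: chart_img_open|exact: chart_img_map].
have /nbhs_closedballP[r hr] := nc.
have r0 : 0 < r%:num by [].
exists (chart_inv c @` closed_ball (c 1%g) r%:num).
  apply: continuous_compact.
    exact: continuous_subspaceW hr (@chart_inv_continuous _ _ _ c).
  apply: bounded_closed_compact; last exact: closed_ball_closed.
  exists (`|c 1%g| + r%:num); split; first exact: num_real.
  move=> M hM y; rewrite closed_ballE // /closed_ball_ /= => hy.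
  have := ler_normB (c 1%g) (c 1%g - y); rewrite opprB addrC subrK; lra.
have cc := chart_map_continuous_at c1.
have := cc _ (nbhsx_ballx (c 1%g) _ r0).
have : nbhs 1%g (chart_dom c) by apply: open_nbhs_nbhs; split=> //; exact: chart_dom_open.
apply: filterS2 => q cq /= bq; exists (c q); last exact: chart_mapK.
exact: subset_closed_ball.
Qed.

(** Compactness replaces an embedding: the points of [C] outside the interior of [W] form a compact
    set, whose image is closed and misses 1 by injectivity. So on [C], closeness to 1 among
    similarities forces closeness to 1 in [L]. *)
Lemma lie_small_nbhs (C W : set L) : compact C -> nbhs 1%g W ->
  exists2 eta : R, 0 < eta &
    forall q, C q -> `|val (f q) - val (1%g : sim R)| < eta -> W q.
Proof.
move=> cC nW.
pose D := C `&` ~` (interior W).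
have cD : compact D.
  by apply: compact_closedI => //; apply: open_closedC; exact: open_interior.
have cfD : compact ((fun p => val (f p)) @` D).
  apply: continuous_compact => //; apply: continuous_subspaceT.
  exact: lie_morph_continuous.
have clD := compact_closed (@norm_hausdorff _ _) cfD.
have : open_nbhs (val (1%g : sim R)) (~` ((fun p => val (f p)) @` D)).
  split; first exact: closed_openC.
  move=> [p [_ Wp]] e; apply: Wp.
  by have -> : p = 1%g by apply: finj; apply: sim_inj; rewrite e lie_morph1.
move=> /open_nbhs_nbhs /nbhs_ballP[eta /= eta0 h]; exists eta => // q Cq fq.
apply: contrapT => Wq; apply: (h (val (f q))).
  by rewrite -ball_normE /ball_ /= distrC.
by exists q => //; split => // /interior_subset.
Qed.

(** Continuity of [gamma] is meant in the topology of [L]; it brings [gamma (t / n)] into any given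
    neighbourhood of 1 in [L]. *)
Definition lie_tangent (X : V) : Prop :=
  exists gamma : R -> L, [/\ gamma 0 = 1%g, {for 0, continuous gamma} &
                             tangent (f \o gamma) X].

(* The powers [gamma (t / n) ^+ m], [m <= n], cannot leave a fixed compact
   neighbourhood of the identity: by continuity of the product a single step
   does not leave it, and [f] separates the identity from the points of the
   neighbourhood which are not close to it.  So their limit [e t] is in the
   image of this neighbourhood. *)
Lemma lie_exp_small X e : lie_tangent X -> one_param e -> tangent e X ->
  exists2 r : R, 0 < r & forall t, `|t| <= r -> range f (e t).
Proof.
move=> [gamma [g0 gc dg]] he de.
have [C cC nC] := lie_compact_nbhs.
have : (nbhs (1%g : L, 1%g : L)) [set p : L * L | C (p.1 * p.2)%g].
  by apply: lie_mul_continuous; rewrite /= mulg1.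
move=> [[W1 W2] /= [nW1 nW2] hW].
pose W := W1 `&` W2.
have nW : nbhs 1%g W by apply: filterI.
have W1C p q : W p -> W q -> C (p * q)%g by move=> [? ?] [? ?]; exact: (hW (p, q)).
have W1g : W 1%g by exact: nbhs_singleton.
have [eta eta0 heta] := lie_small_nbhs cC nW.
pose K := 1 + `|X|.
have K0 : 0 < K by rewrite /K; have := normr_ge0 X; lra.
pose m := Num.min eta 1.
have m0 : 0 < m by rewrite lt_min eta0 ltr01.
(* With this radius all the steps together move by at most [12 * K * |t| <= m / 4], below [eta] and
   below the bounds 1 and 1/2 required for comparing powers. *)
exists (m / (48 * K)); first by rewrite divr_gt0 // mulr_gt0.
move=> t ht.
have tK : 48 * K * `|t| <= m by move: ht; rewrite ler_pdivlMr ?mulr_gt0 // mulrC.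
have [m1 m2] : m <= 1 /\ m <= eta by rewrite !ge_min !lexx orbT.
have cfC : closed ((fun p => val (f p)) @` C).
  apply: compact_closed; first exact: norm_hausdorff.
  apply: continuous_compact => //; apply: continuous_subspaceT.
  exact: lie_morph_continuous.
suff [q _ hq] : ((fun p => val (f p)) @` C) (val (e t)).
  by exists q => //; apply: sim_inj.
apply: cfC => B /nbhs_ballP[eps /= eps0 hB].
(* The factor 24 in the comparison of powers leaves an error [24 * dl * |t| < eps]; [1 + |t|] keeps
   the denominator positive when [t = 0]. *)
pose dl := eps / (48 * (1 + `|t|)).
have t1 : 0 < 1 + `|t| by have := normr_ge0 t; lra.
have dl0 : 0 < dl by rewrite divr_gt0 // mulr_gt0.
have Hn : \forall s \near (0 : R), [/\ W (gamma s),
   `|val (f (gamma s)) - val (1%g : sim R)| <= K * `|s|,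
   `|val (e s) - val (1%g : sim R)| <= K * `|s| &
   `|val (f (gamma s)) - val (e s)| <= dl * `|s|].
  near=> s; split.
  - by near: s; apply: gc; rewrite g0.
  - by near: s; exact: tangent_lipschitz dg.
  - by near: s; exact: tangent_lipschitz de.
  by near: s; exact: tangent_dist dg de dl0.
have [rho /= rho0 hrho] := (nbhs_ballP _ _).1 Hn.
have [n hn] : exists n : nat, `|t| / rho < n.+1%:R.
  exists (Num.truncn (`|t| / rho)).
  by rewrite truncnS_gt // divr_ge0 // ltW.
pose s := t / n.+1%:R.
have n0 : 0 < n.+1%:R :> R by rewrite ltr0n.
have sE : n.+1%:R * `|s| = `|t|.
  by rewrite /s normrM normfV (ger0_norm (ltW n0)) mulrC divfK // gt_eqF.
have [Wg h1 h2 h3] : [/\ W (gamma s),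
   `|val (f (gamma s)) - val (1%g : sim R)| <= K * `|s|,
   `|val (e s) - val (1%g : sim R)| <= K * `|s| &
   `|val (f (gamma s)) - val (e s)| <= dl * `|s|].
  apply: hrho; rewrite -ball_normE /ball_ /= sub0r normrN.
  rewrite /s normrM normfV (ger0_norm (ltW n0)) ltr_pdivrMr //.
  by move: hn; rewrite ltr_pdivrMr // mulrC.
have s0 := normr_ge0 s.
have b1 j : (j <= n.+1)%N -> j%:R * (12 * `|val (f (gamma s)) - val (1%g : sim R)|) <= m / 4.
  move=> jn; have : j%:R * (12 * `|val (f (gamma s)) - val (1%g : sim R)|) <= n.+1%:R * (12 * (K * `|s|)).
    by apply: ler_pM => //; [rewrite ler_nat|rewrite ler_pM2l].
  have -> : n.+1%:R * (12 * (K * `|s|)) = 12 * K * `|t| by rewrite -sE; ring.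
  lra.
have b2 : n.+1%:R * (12 * `|val (e s) - val (1%g : sim R)|) <= 1 / 2.
  have : n.+1%:R * (12 * `|val (e s) - val (1%g : sim R)|) <= n.+1%:R * (12 * (K * `|s|)).
    by rewrite ler_pM2l // ler_pM2l.
  have -> : n.+1%:R * (12 * (K * `|s|)) = 12 * K * `|t| by rewrite -sE; ring.
  lra.
have Wj j : (j <= n.+1)%N -> W (gamma s ^+ j)%g.
  elim: j => [_|j IHj jn]; first by rewrite expg0.
  have Cj : C (gamma s ^+ j.+1)%g by rewrite expgSr; apply: W1C => //; apply: IHj; exact: ltnW.
  apply: (heta _ Cj); rewrite lie_morphX.
  have hb := b1 _ jn; have hb1 : j.+1%:R * (12 * `|val (f (gamma s)) - val (1%g : sim R)|) <= 1 by lra.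
  by apply: le_lt_trans (dist_simX hb1) _; lra.
exists (val (f (gamma s ^+ n.+1)%g)); split.
  by exists (gamma s ^+ n.+1)%g => //; rewrite -[X in C X]mulg1; apply: W1C => //; exact: Wj.
apply: hB; rewrite -ball_normE /ball_ /=.
have -> : e t = (e s ^+ n.+1)%g.
  by rewrite -one_paramX // -mulr_natr divfK // gt_eqF.
rewrite lie_morphX distrC.
have hb1 : n.+1%:R * (12 * `|val (f (gamma s)) - val (1%g : sim R)|) <= 1.
  by have := b1 _ (leqnn _); lra.
apply: le_lt_trans (dist_simXX hb1 b2) _.
have : 24 * n.+1%:R * `|val (f (gamma s)) - val (e s)| <= 24 * n.+1%:R * (dl * `|s|).
  by rewrite ler_pM2l // mulr_gt0.
have -> : 24 * n.+1%:R * (dl * `|s|) = 24 * dl * `|t| by rewrite -sE; ring.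
move=> h; apply: le_lt_trans h _.
have : dl * (48 * (1 + `|t|)) = eps by rewrite /dl divfK // gt_eqF // mulr_gt0.
have := normr_ge0 t; nra.
Unshelve. all: by end_near. Qed.

(** An element of a one-parameter group is a power of an element at a small time. *)
Lemma lie_exp X e t : lie_tangent X -> one_param e -> tangent e X -> range f (e t).
Proof.
move=> hX he de; have [r r0 hr] := lie_exp_small hX he de.
have [n hn] : exists n : nat, `|t| / r < n.+1%:R.
  exists (Num.truncn (`|t| / r)).
  by rewrite truncnS_gt // divr_ge0 // ltW.
have n0 : 0 < n.+1%:R :> R by rewrite ltr0n.
have [|q _ hq] := hr (t / n.+1%:R).
  rewrite normrM normfV (ger0_norm (ltW n0)) ler_pdivrMr //.
  by apply: ltW; move: hn; rewrite ltr_pdivrMr // mulrC.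
exists (q ^+ n.+1)%g => //.
by rewrite lie_morphX hq -one_paramX // -(mulr_natr (t / _)) divfK // gt_eqF.
Qed.

End LieGroup.

(** * Tangent vectors of a Lie subgroup *)

Section Ord3.

Lemma ord3_ind (P : 'I_3 -> Prop) : P 0 -> P 1 -> P 2 -> forall i, P i.
Proof.
by move=> P0 P1 P2 [[|[|[|//]]] h]; [have <- : 0 = Ordinal h|have <- : 1 = Ordinal h
  |have <- : 2 = Ordinal h]; try exact: val_inj.
Qed.

Lemma sum_ord3 (V : nmodType) (F : 'I_3 -> V) : \sum_(i < 3) F i = F 0 + F 1 + F 2.
Proof.
rewrite !big_ord_recl big_ord0 addr0 addrA.
by congr (F _ + F _ + F _); exact: val_inj.
Qed.

Lemma det_mx33 (K : comNzRingType) (A : 'M[K]_3) :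
  \det A = A 0 0 * (A 1 1 * A 2 2 - A 1 2 * A 2 1)
         - A 0 1 * (A 1 0 * A 2 2 - A 1 2 * A 2 0)
         + A 0 2 * (A 1 0 * A 2 1 - A 1 1 * A 2 0).
Proof.
pose a m n := A (inord m) (inord n).
have aE i j : A i j = a i j by rewrite /a !inord_val.
rewrite (expand_det_row _ 0) !big_ord_recl big_ord0 /cofactor.
rewrite !(expand_det_row _ ord0) !big_ord_recl !big_ord0 /cofactor !det_mx11 !mxE.
by rewrite !aE /= /bump /=; ring.
Qed.

End Ord3.

Section PartsContinuous.
Context {R : realType}.
Local Notation V := (R * 'M[R]_3 * 'cV[R]_3)%type.

Lemma scale_part_continuous : continuous (fun y : V => y.1.1).
Proof. by move=> y; apply: (@cvg_comp _ _ _ fst fst); exact: cvg_fst. Qed.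

Lemma linear_part_continuous i j : continuous (fun y : V => y.1.2 i j).
Proof.
move=> y; apply: (@cvg_comp _ _ _ (fun y : V => y.1.2) (fun A : 'M[R]_3 => A i j)).
  by apply: (@cvg_comp _ _ _ fst snd); [exact: cvg_fst|exact: cvg_snd].
exact: coord_continuous.
Qed.

End PartsContinuous.

Lemma connected_clopen (T : topologicalType) (B : set T) :
  connected [set: T] -> B !=set0 -> open B -> closed B -> B = [set: T].
Proof. by move=> cT B0 oB cB; apply: cT => //; exists B; rewrite ?setTI. Qed.

Section LieTangent.
Context {R : realType} {k : nat} (L : lieGroupType R k) (f : L -> sim R).
Local Notation V := (R * 'M[R]_3 * 'cV[R]_3)%type.
Hypotheses (Lconn : connected [set: L]) (fM : {morph f : p q / (p * q)%g}).
Hypotheses (finj : injective f).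
Hypotheses (fsmooth : forall c : chart R k L, lie_atlas c ->
  smooth_on (chart_img c) (sim_val \o f \o chart_inv c)).

Let f1 : f 1%g = 1%g := lie_morph1 fM.
Let fV p : f p^-1%g = (f p)^-1%g := lie_morphV fM p.

Lemma continuous_mulg (T : topologicalType) (g h : T -> L) x :
  {for x, continuous g} -> {for x, continuous h} ->
  {for x, continuous (fun s => g s * h s)%g}.
Proof.
move=> cg ch.
apply: (@continuous2_cvg _ _ _ _ (nbhs x) _ g h (fun a b => a * b)%g (g x) (h x)) => //.
exact: (@lie_mul_continuous _ _ L (g x, h x)).
Qed.

Lemma lie_tangentD X Y : lie_tangent f X -> lie_tangent f Y -> lie_tangent f (X + Y).
Proof.
move=> [g [g0 gc gt]] [h [h0 hc ht]].
exists (fun s => g s * h s)%g; split; first by rewrite g0 h0 mulg1.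
  exact: continuous_mulg.
have -> : f \o (fun s => (g s * h s)%g) = fun s => ((f \o g) s * (f \o h) s)%g.
  by apply/funext => s /=; rewrite fM.
exact: tangentM.
Qed.

Lemma lie_tangentZ a X : lie_tangent f X -> lie_tangent f (a *: X).
Proof.
move=> [g [g0 gc gt]]; exists (fun s => g (a * s)); split; first by rewrite mulr0.
  apply: (@continuous_comp _ _ _ (fun s : R => a * s) g).
    exact: mulrl_continuous.
  by rewrite mulr0.
exact: (tangentZ a gt).
Qed.

Lemma lie_tangent_Ad p X : lie_tangent f X -> lie_tangent f (Ad (f p) X).
Proof.
move=> [g [g0 gc gt]]; exists (fun s => p * g s * p^-1)%g.
split; first by rewrite g0 mulg1 mulgV.
  by apply: continuous_mulg; [apply: continuous_mulg => //|]; exact: cvg_cst.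
have -> : f \o (fun s => (p * g s * p^-1)%g) = fun s => (f p * (f \o g) s * (f p)^-1)%g.
  by apply/funext => s /=; rewrite !fM fV.
exact: tangent_conj.
Qed.

Lemma is_derive0_cvg (g : R -> R) d :
  (fun h => h^-1 * (g h - g 0)) @ 0^' --> d -> is_derive (0 : R) (1 : R) g d.
Proof.
move=> H.
have H' : (fun h : R => h^-1 *: (g (h *: (1 : R) + 0) - g 0)) @ 0^' --> d.
  by under eq_fun do rewrite addr0 /GRing.scale /= mulr1.
split; first by apply/cvg_ex; exists d.
exact: cvg_lim H'.
Qed.

Lemma velocity_chart (c : chart R k L) x v : lie_atlas c -> chart_img c x ->
  velocity (fun s => f (chart_inv c (s *: v + x)))
    ('d (sim_val \o f \o chart_inv c) x v).
Proof.
move=> Ac cx; set F := sim_val \o f \o chart_inv c.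
have [dF _] := fsmooth Ac 1%N.
have D : (fun h => h^-1 *: (F (h *: v + x) - F x)) @ 0^' --> 'd F x v.
  by rewrite -deriveE; [exact: (@diff_derivable _ _ _ F x v (dF x cx))|exact: dF].
have F0 : F x = val (f (chart_inv c (0 *: v + x))) by rewrite scale0r add0r.
have key (pr : V -> R) : continuous pr ->
    (forall (a : R) (y z : V), pr (a *: (y - z)) = a * (pr y - pr z)) ->
    is_derive (0 : R) (1 : R) (fun s => pr (F (s *: v + x))) (pr ('d F x v)).
  move=> cpr hpr; apply: is_derive0_cvg; rewrite scale0r add0r.
  under eq_fun do rewrite -hpr.
  exact: (@cvg_comp _ _ _ _ pr _ _ _ D (cpr _)).
split=> [|i j|i].
- apply: (key (fun y => y.1.1)) => [|a y z]; last by rewrite /= /GRing.scale /=.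
  exact: scale_part_continuous.
- apply: (key (fun y => y.1.2 i j)) => [|a y z]; last by rewrite /= !mxE.
  exact: linear_part_continuous.
apply: (key (fun y => y.2 i 0)) => [y|a y z]; last by rewrite /= !mxE.
apply: (@cvg_comp _ _ _ snd (fun A : 'cV[R]_3 => A i 0)); first exact: cvg_snd.
exact: coord_continuous.
Qed.

(** A segment through [x] in the chart, moved to the identity by a left translation; its velocity is
    the left logarithmic derivative of [f] at [x] along [v]. *)
Definition chart_line (c : chart R k L) x v (s : R) : L :=
  ((chart_inv c x)^-1 * chart_inv c (s *: v + x))%g.

Lemma chart_line_tangent (c : chart R k L) x v : lie_atlas c -> chart_img c x ->
  tangent (f \o chart_line c x v)
    (left_trans (f (chart_inv c x))^-1%g ('d (sim_val \o f \o chart_inv c) x v)).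
Proof.
move=> Ac cx; split; first by rewrite /= /chart_line scale0r add0r mulVg.
have := velocity_left (f (chart_inv c x))^-1%g (velocity_chart v Ac cx).
have -> // : f \o chart_line c x v =
  fun s => ((f (chart_inv c x))^-1 * f (chart_inv c (s *: v + x)))%g.
by apply/funext => s; rewrite /= /chart_line fM fV.
Qed.

(** At the identity this provides independent velocities; at other points it lets a function be
    differentiated along chart segments while only left-invariant directions of [g] occur. *)
Lemma lie_tangent_chart (c : chart R k L) x v : lie_atlas c -> chart_img c x ->
  lie_tangent f
    (left_trans (f (chart_inv c x))^-1%g ('d (sim_val \o f \o chart_inv c) x v)).
Proof.
move=> Ac cx; exists (chart_line c x v); split; last exact: chart_line_tangent.
  by rewrite /chart_line scale0r add0r mulVg.
apply: continuous_mulg; first exact: cvg_cst.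
apply: (@continuous_comp _ _ _ (fun s : R => s *: v + x) (chart_inv c)).
  apply: continuousD; last exact: cvg_cst.
  exact: scalel_continuous.
by rewrite scale0r add0r; exact: chart_inv_continuous_at.
Qed.

(* A function whose derivative along every left-invariant direction vanishes
   is constant, since [L] is connected. *)
Lemma lie_invariant_cst (u : sim R -> R) :
  (forall p N X, lie_tangent f X -> tangent N X ->
     is_derive (0 : R) (1 : R) (fun s => u (f p * N s)%g) 0) ->
  forall p, u (f p) = u 1%g.
Proof.
move=> hu p0.
have loc p : \forall q \near p, u (f q) = u (f p).
  have [hA _] := @lie_atlasP _ _ L; have [c Ac cp] := hA p.
  have nc : nbhs (c p) (chart_img c).
    apply: open_nbhs_nbhs; split; [exact: chart_img_open|exact: chart_img_map].
  have /nbhs_ballP[r /= r0 hr] := nc.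
  have := chart_map_continuous_at cp (nbhsx_ballx (c p) _ r0).
  have : nbhs p (chart_dom c) by apply: open_nbhs_nbhs; split=> //; exact: chart_dom_open.
  apply: filterS2 => q cq; rewrite /= -ball_normE /ball_ /= => bq.
  pose v := c q - c p.
  have bv : `|v| < r by rewrite distrC.
  pose h t := u (f (chart_inv c (c p + t *: v))).
  have hh (t : R) : 0 <= t <= 1 -> is_derive t (1 : R) h 0.
    move=> t01; pose x := c p + t *: v.
    have cx : chart_img c x.
      apply: hr; rewrite -ball_normE /ball_ /= /x opprD addrA subrr sub0r normrN normrZ.
      by apply: le_lt_trans bv; rewrite ler_piMl // ger0_norm; case/andP: t01.
    (* Up to a shift of the parameter, the left translate of [chart_line] by the point at [x] is the
       segment itself. *)
    have := hu (chart_inv c x) _ _ (lie_tangent_chart v Ac cx) (chart_line_tangent v Ac cx).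
    have -> : (fun s => u (f (chart_inv c x) * (f \o chart_line c x v) s)%g) = fun s => h (s + t).
      apply/funext => s; rewrite /= -fM /chart_line mulVKg /h /x; congr (u (f (chart_inv c _))).
      by rewrite scalerDl addrCA.
    move=> H.
    have dt : is_derive t (1 : R) (fun s => s - t) (1 : R).
      by apply: is_derive_eq (is_deriveB (is_derive_id _ _) (is_derive_cst _ _ _)) _; rewrite subr0.
    have H' : is_derive (t - t) (1 : R) (fun s => h (s + t)) 0 by rewrite subrr.
    have := @is_derive1_comp R (fun s => h (s + t)) (fun s => s - t) t 0 1 H' dt; rewrite mul0r.
    have -> // : (fun s => h (s + t)) \o (fun s => s - t) = h.
    by apply/funext => s /=; rewrite subrK.
  have [|||y _] := @MVT_segment R h (fun=> 0) 0 1 _ _ _.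
  - exact: ler01.
  - by move=> t; rewrite in_itv /= => /andP[/ltW t0 /ltW t1]; apply: hh; rewrite t0.
  - apply: derivable_within_continuous => t; rewrite in_itv /= => t01.
    by have [] := hh t t01.
  rewrite mul0r /h scale0r scale1r addr0 /v (addrC (c p)) subrK !chart_mapK // => /eqP.
  by rewrite subr_eq0 => /eqP.
pose B := [set p | u (f p) = u 1%g].
have oB : open B.
  rewrite openE => p Bp; apply: filterS (loc p) => q; rewrite /B /= => ->; exact: Bp.
have cB : closed B.
  rewrite -[B]setCK; apply: open_closedC; rewrite openE => p Bp.
  by apply: filterS (loc p) => q; rewrite /B /= => ->; exact: Bp.
suff : [set: L] p0 by rewrite -(connected_clopen Lconn _ oB cB) //; exists 1%g; rewrite /B /= f1.
by [].
Qed.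

Let fc := lie_morph_continuous fsmooth.

(** The scale never vanishes, so its positivity is both an open and a closed condition on the
    connected group [L]. *)
Lemma lie_scale_gt0 p : 0 < (val (f p)).1.1.
Proof.
have ca : continuous (fun p => (val (f p)).1.1).
  move=> q; apply: (@continuous_comp _ _ _ (fun p => val (f p)) (fun y : V => y.1.1)).
    exact: fc.
  exact: scale_part_continuous.
pose B := [set p | 0 < (val (f p)).1.1].
have oB : open B.
  by apply: (@open_comp _ _ (fun p => (val (f p)).1.1) [set x | 0 < x]) => [q _|]; [exact: ca|exact: open_gt].
have cB : closed B.
  have -> : B = (fun p => (val (f p)).1.1) @^-1` [set x | 0 <= x].
    by apply/seteqP; split => q /=; rewrite /B /= lt0r ?sim_scale_neq0 // => /andP[].
  by apply: closed_comp; [move=> q _; exact: ca|exact: closed_ge].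
suff : [set: L] p by rewrite -(connected_clopen Lconn _ oB cB) //; exists 1%g; rewrite /B /= f1 /= ltr01.
by [].
Qed.

Lemma lie_det p : \det (val (f p)).1.2 = 1.
Proof.
have ca i j : continuous (fun p => (val (f p)).1.2 i j).
  move=> q; apply: (@continuous_comp _ _ _ (fun p => val (f p)) (fun y : V => y.1.2 i j)).
    exact: fc.
  exact: linear_part_continuous.
have cd : continuous (fun p => \det (val (f p)).1.2).
  under eq_fun do rewrite det_mx33.
  move=> q; apply: cvgD; [apply: cvgB|]; apply: cvgM; try exact: ca;
    apply: cvgB; apply: cvgM; exact: ca.
have d1 q : (\det (val (f q)).1.2) ^+ 2 = 1.
  by rewrite expr2 -{2}det_tr -det_mulmx sim_orthor det1.
pose B := [set p | 0 < \det (val (f p)).1.2].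
have oB : open B.
  by apply: (@open_comp _ _ (fun p => \det (val (f p)).1.2) [set x | 0 < x]) => [q _|]; [exact: cd|exact: open_gt].
have cB : closed B.
  have -> : B = (fun p => \det (val (f p)).1.2) @^-1` [set x | 0 <= x].
    apply/seteqP; split => q /=; rewrite /B /= lt0r; first by case/andP.
    move=> ->; rewrite andbT; apply/eqP => d0.
    by have /eqP := d1 q; rewrite d0 expr0n /= eq_sym oner_eq0.
  by apply: closed_comp; [move=> q _; exact: cd|exact: closed_ge].
have Bp : B p.
  suff : [set: L] p by rewrite -(connected_clopen Lconn _ oB cB) //; exists 1%g; rewrite /B /= f1 /= det1 ltr01.
  by [].
by have /eqP := d1 p; rewrite sqrf_eq1 => /orP[/eqP //|/eqP dp]; move: Bp; rewrite /B /= dp oppr_gt0 ltr10.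
Qed.

End LieTangent.

(** * The group together with its set of velocities *)

Section LiePair.
Context {R : realType}.
Local Notation V := (R * 'M[R]_3 * 'cV[R]_3)%type.
Implicit Types (G : set (sim R)) (g : set V) (x y h : sim R) (X Y : V).

(* What the classification uses of [G] and of its Lie algebra [g]; these
   properties are invariant under conjugation, unlike the setting in which they
   are obtained. *)
Record lie_pair G g : Prop := LiePair {
  lp_group : is_subgroup G;
  lp_addr : forall X Y, g X -> g Y -> g (X + Y);
  lp_scale : forall a X, g X -> g (a *: X);
  lp_skew : forall X, g X -> X.1.2^T = - X.1.2;
  lp_Ad : forall x X, G x -> g X -> g (Ad x X);
  lp_exp : forall X e t, g X -> one_param e -> tangent e X -> G (e t);
  lp_cst : forall u : sim R -> R,
    (forall x N X, G x -> g X -> tangent N X ->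
       is_derive (0 : R) (1 : R) (fun s => u (x * N s)%g) 0) ->
    forall x, G x -> u x = u 1%g;
  lp_indep : exists X Y, [/\ g X, g Y &
    forall a b : R, a *: X + b *: Y = 0 -> a = 0 /\ b = 0];
  lp_gt0 : forall x, G x -> 0 < (val x).1.1;
  lp_det : forall x, G x -> \det (val x).1.2 = 1
}.

Lemma connected_lie_pair k G : (2 <= k)%N -> connected_lie_subgroup k G ->
  exists g, lie_pair G g.
Proof.
move=> k2 [L [f [Lconn fM finj fG fch]]].
have fs c : lie_atlas c -> smooth_on (chart_img c) (sim_val \o f \o chart_inv c).
  by move=> /fch[].
have f1 := lie_morph1 fM.
exists (lie_tangent f); subst G; split.
- split; first by exists 1%g.
  move=> _ _ [p _ <-] [q _ <-]; exists (p / q)%g => //.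
  by rewrite fM (lie_morphV fM).
- by move=> X Y; exact: lie_tangentD.
- by move=> a X; exact: lie_tangentZ.
- by move=> X [gam [_ _]]; exact: tangent_skew.
- by move=> _ X [p _ <-]; exact: lie_tangent_Ad.
- by move=> X e t; exact: (lie_exp fM finj fs).
- move=> u hu _ [p _ <-]; apply: (lie_invariant_cst Lconn fM fs) => q N X.
  by apply: hu; exists q.
- have [hA _] := @lie_atlasP _ _ L; have [c Ac c1] := hA 1%g.
  have [_ /(_ _ (chart_img_map c1)) inj] := fch c Ac.
  have i0 : (0 < k)%N by exact: ltn_trans k2.
  (* Two basis vectors of the model space; injectivity of the differential at the identity keeps
     their images independent. *)
  pose v (i : 'I_k) : 'rV[R]_k := delta_mx 0 i.
  pose D := 'd (sim_val \o f \o chart_inv c) (c 1%g).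
  have gD w : lie_tangent f (D w).
    have := lie_tangent_chart fM fs w Ac (chart_img_map c1).
    rewrite chart_mapK // f1 invg1 -/D; case: (D w) => [[a A] b].
    by rewrite /left_trans /= mul1r !mul1mx scale1r.
  exists (D (v (Ordinal i0))), (D (v (Ordinal k2))); split => // a b.
  rewrite -!linearZ -linearD -[RHS](linear0 D) => /inj /matrixP e.
  move: (e 0 (Ordinal i0)) (e 0 (Ordinal k2)).
  by rewrite !mxE !eqxx /= mulr1 mulr0 addr0 mulr1 mulr0 add0r.
- by move=> _ [p _ <-]; exact: (lie_scale_gt0 Lconn fM fs).
- by move=> _ [p _ <-]; exact: (lie_det Lconn fM fs).
Qed.

Lemma AdD x X Y : Ad x (X + Y) = Ad x X + Ad x Y.
Proof.
congr (_, _, _) => /=; first by rewrite mulmxDr mulmxDl.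
rewrite !mulmxDr !mulmxDl scalerDr scalerDl !opprD.
apply/matrixP => i j; rewrite !mxDE; ring.
Qed.

Lemma AdZ x a X : Ad x (a *: X) = a *: Ad x X.
Proof.
congr (_, _, _) => /=; first by rewrite -scalemxAr -scalemxAl.
rewrite -!scalemxAr -!scalemxAl !scalerBr !scalerA.
by rewrite [_ * a]mulrC.
Qed.

Lemma AdM x y X : Ad (x * y)%g X = Ad x (Ad y X).
Proof.
congr (_, _, _); rewrite /= ?trmx_mul ?mulmxA //.
set A := (val x).1.2; set B := (val y).1.2; set M := A *m B *m X.1.2 *m B^T.
have AA : A^T *m A = 1%:M by exact: sim_orthol.
have e (P : 'M[R]_3) : P *m A^T *m ((val x).1.1 *: (A *m (val y).2) + (val x).2) =
    (val x).1.1 *: (P *m (val y).2) + P *m A^T *m (val x).2.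
  by rewrite mulmxDr -scalemxAr mulmxA -(mulmxA P _ A) AA mulmx1.
rewrite e.
rewrite !mulmxBr !scalerBr -!scalemxAr !mulmxA !scalerDr !scalerA.
rewrite -/M [X.1.1 * _]mulrC.
apply/matrixP => i j; rewrite !(mxDE, mxZE, mxE); ring.
Qed.

Lemma Ad1 X : Ad 1%g X = X.
Proof.
case: X => [[a A] v].
by rewrite /Ad /= trmx1 mulmx1 !mul1mx scale1r scaler0 mulmx0 !subr0.
Qed.

Definition conj_set h G : set (sim R) := [set (h * x * h^-1)%g | x in G].
Definition Ad_set h g : set V := [set Ad h X | X in g].

(** Everything is carried back by [h^-1]: one-parameter groups are conjugated, and a test function
    [u] is composed with the conjugation by [h]. *)
Lemma lie_pair_conj h G g : lie_pair G g -> lie_pair (conj_set h G) (Ad_set h g).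
Proof.
move=> [[G1 GB] gD gZ gS gA gE gC [X [Y [gX gY XY]]] g0 gd].
have AdK Z : Ad h^-1%g (Ad h Z) = Z by rewrite -AdM mulVg Ad1.
split.
- split; first by exists 1%g => //; rewrite mulg1 mulgV.
  move=> _ _ [x Gx <-] [y Gy <-]; exists (x / y)%g; first exact: GB.
  by rewrite !invgM invgK !mulgA mulgVK.
- by move=> _ _ [Z gZ' <-] [Z' gZ'' <-]; exists (Z + Z'); rewrite ?AdD //; exact: gD.
- by move=> a _ [Z gZ' <-]; exists (a *: Z); rewrite ?AdZ //; exact: gZ.
- move=> _ [Z /gS gZ' <-] /=.
  by rewrite !trmx_mul trmxK gZ' mulNmx mulmxN mulmxA.
- move=> _ _ [x Gx <-] [Z gZ' <-]; exists (Ad x Z); first exact: gA.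
  by rewrite -!AdM mulgVK.
- move=> _ e t [Z gZ' <-] he de.
  exists (h^-1 * e t * h)%g; last by rewrite !mulgA mulgV mul1g mulgK.
  apply: (gE Z (fun t => h^-1 * e t * h)%g) => //.
    by move=> s s'; rewrite he !mulgA mulgK.
  by have := tangent_conj h^-1%g de; rewrite AdK invgK.
- move=> u hu _ [x Gx <-].
  have := gC (fun x => u (h * x * h^-1)%g) _ x Gx.
  rewrite mulg1 mulgV; apply => {Gx}x N Z Gx gZ' dN.
  have := hu (h * x * h^-1)%g (fun s => h * N s * h^-1)%g (Ad h Z) _ _ (tangent_conj h dN).
  have -> : (fun s => u (h * x * h^-1 * (h * N s * h^-1))%g) = (fun s => u (h * (x * N s) * h^-1)%g).
    by apply/funext => s; rewrite !mulgA mulgVK.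
  by apply; [exists x|exists Z].
- exists (Ad h X), (Ad h Y); split; [by exists X|by exists Y|] => a b.
  rewrite -!AdZ -AdD => e; apply: XY; rewrite -(AdK (_ + _)) e.
  by rewrite -(scale0r (0 : V)) AdZ !scale0r.
- move=> _ [x Gx <-] /=; rewrite mulrAC divff ?mul1r; last exact: sim_scale_neq0.
  exact: g0.
- move=> _ [x Gx <-] /=; rewrite !det_mulmx (gd x Gx) mulr1 -det_mulmx sim_orthor.
  exact: det1.
Qed.

End LiePair.

(** * Coordinates on the Lie algebra *)

Section Coordinates.
Context {R : realType}.
Local Notation V := (R * 'M[R]_3 * 'cV[R]_3)%type.
Implicit Types (X Y : V).
Implicit Types (a p q r t x y z : R).

Definition vec3 p q r : 'cV[R]_3 := \col_i nth 0 [:: p; q; r] i.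

(** The matrix of the cross product of its argument with the vector [(x, y, z)], in this order; for
    a nonzero vector the kernel is the axis of rotation. *)
Definition sk (x y z : R) : 'M[R]_3 := \matrix_(i, j)
  nth 0 (nth [::] [:: [:: 0; z; - y]; [:: - z; 0; x]; [:: y; - x; 0]] i) j.

Lemma cv3P (v w : 'cV[R]_3) : [/\ v 0 0 = w 0 0, v 1 0 = w 1 0 & v 2 0 = w 2 0] -> v = w.
Proof.
by move=> [e0 e1 e2]; apply/matrixP => i j; rewrite ord1; elim/ord3_ind: i.
Qed.

Lemma vec3_eta (v : 'cV[R]_3) : v = vec3 (v 0 0) (v 1 0) (v 2 0).
Proof. by apply: cv3P; rewrite !mxE. Qed.

Lemma sk_eta (A : 'M[R]_3) : A^T = - A -> A = sk (A 1 2) (A 2 0) (A 0 1).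
Proof.
move=> /matrixP AA.
have A0 i : A i i = 0.
  by have := AA i i; rewrite !mxE => /eqP; rewrite -addr_eq0 -mulr2n mulrn_eq0 => /eqP.
have AN i j : A j i = - A i j by have := AA i j; rewrite !mxE.
apply/matrixP => i j; elim/ord3_ind: i; elim/ord3_ind: j; rewrite !mxE //= ?A0 //; exact: AN.
Qed.

Lemma skD x y z x' y' z' : sk x y z + sk x' y' z' = sk (x + x') (y + y') (z + z').
Proof.
apply/matrixP => i j; elim/ord3_ind: i; elim/ord3_ind: j; rewrite !mxE /=; ring.
Qed.

Lemma skZ a x y z : a *: sk x y z = sk (a * x) (a * y) (a * z).
Proof.
apply/matrixP => i j; elim/ord3_ind: i; elim/ord3_ind: j; rewrite !mxE /=; ring.
Qed.

Lemma vec3D p q r p' q' r' : vec3 p q r + vec3 p' q' r' = vec3 (p + p') (q + q') (r + r').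
Proof. by apply: cv3P; rewrite !mxE. Qed.

Lemma vec3Z a p q r : a *: vec3 p q r = vec3 (a * p) (a * q) (a * r).
Proof. by apply: cv3P; rewrite !mxE. Qed.

Lemma sk_vec3 x y z p q r :
  sk x y z *m vec3 p q r = vec3 (z * q - y * r) (x * r - z * p) (y * p - x * q).
Proof. by apply: cv3P; rewrite !mxE !sum_ord3 !mxE /=; split; ring. Qed.

Lemma sk0 : sk 0 0 0 = 0.
Proof.
apply/matrixP => i j; elim/ord3_ind: i; elim/ord3_ind: j; rewrite !mxE /=; ring.
Qed.

Lemma vec30 : vec3 0 0 0 = 0.
Proof. by apply: cv3P; rewrite !mxE. Qed.

Lemma rot_vec3 t p q r : rot t *m vec3 p q r =
  vec3 (cos t * p + sin t * q) (- sin t * p + cos t * q) r.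
Proof. by apply: cv3P; rewrite !mxE !sum_ord3 !mxE /=; split; ring. Qed.

Lemma rotD (s t : R) : rot (s + t) = rot s *m rot t.
Proof.
apply/matrixP => i j; elim/ord3_ind: i; elim/ord3_ind: j;
  rewrite !mxE ?sum_ord3 !mxE /= ?sinD ?cosD; ring.
Qed.

Lemma rot0 : rot (0 : R) = 1%:M.
Proof.
apply/matrixP => i j; elim/ord3_ind: i; elim/ord3_ind: j;
  rewrite !mxE /= ?sin0 ?cos0 ?oppr0 //.
Qed.

Lemma trmx_rot t : (rot t)^T = rot (- t).
Proof.
apply/matrixP => i j; elim/ord3_ind: i; elim/ord3_ind: j;
  rewrite !mxE /= ?sinN ?cosN ?opprK //.
Qed.

Lemma rot_orth t : rot t *m (rot t)^T = 1%:M.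
Proof. by rewrite trmx_rot -rotD subrr rot0. Qed.

Lemma rot_sk t x y z : rot t *m sk x y z *m (rot t)^T =
  sk (cos t * x + sin t * y) (- sin t * x + cos t * y) z.
Proof.
have e : cos t ^+ 2 = 1 - sin t ^+ 2 := cos2sin2 t.
apply/matrixP => i j; elim/ord3_ind: i; elim/ord3_ind: j;
  rewrite !mxE !sum_ord3 !mxE !sum_ord3 !mxE /=; ring: e.
Qed.

(* The sign of [sk] is such that [sk 0 0 1] is the velocity of [rot] at 0. *)
Definition tvec a x y z p q r : V := (a, sk x y z, vec3 p q r).

Lemma tvecD a x y z p q r a' x' y' z' p' q' r' :
  tvec a x y z p q r + tvec a' x' y' z' p' q' r' =
  tvec (a + a') (x + x') (y + y') (z + z') (p + p') (q + q') (r + r').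
Proof. by congr (_, _, _) => /=; rewrite ?skD ?vec3D. Qed.

Lemma tvecZ c a x y z p q r : c *: tvec a x y z p q r =
  tvec (c * a) (c * x) (c * y) (c * z) (c * p) (c * q) (c * r).
Proof. by congr (_, _, _) => /=; rewrite ?skZ ?vec3Z. Qed.

Fact mksim_subproof a (A : 'M[R]_3) v : a != 0 -> A *m A^T = 1%:M -> is_sim (a, A, v).
Proof. by move=> a0 AA; rewrite /is_sim /= a0 AA eqxx. Qed.

Definition mksim a (A : 'M[R]_3) v (a0 : a != 0) (AA : A *m A^T = 1%:M) : sim R :=
  Sim (mksim_subproof v a0 AA).

Lemma id_orth : (1%:M : 'M[R]_3) *m 1%:M^T = 1%:M.
Proof. by rewrite trmx1 mulmx1. Qed.

Lemma expR_neq0 t : expR t != 0.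
Proof. by rewrite gt_eqF ?expR_gt0. Qed.

(** The homothety of ratio [expR t] centred at [- w]. *)
Definition hom_exp (w : 'cV[R]_3) t : sim R :=
  mksim ((expR t - 1) *: w) (expR_neq0 t) id_orth.

Definition trans_exp (u : 'cV[R]_3) t : sim R := mksim (t *: u) (oner_neq0 R) id_orth.

(** A rotation about [e_3] with dilation rate [a] and pitch [p]; the formula is multiplicative in
    [t] exactly when [a * p = 0]. *)
Definition screw_exp a p t : sim R :=
  mksim (vec3 0 0 (p * t)) (expR_neq0 (a * t)) (rot_orth t).

Lemma hom_exp_one_param w : one_param (hom_exp w).
Proof.
move=> s t; apply: sim_inj; rewrite val_simM /=; congr (_, _, _).
- by rewrite expRD.
- by rewrite mulmx1.
by rewrite mul1mx scalerA -scalerDl expRD; congr (_ *: _); ring.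
Qed.

Lemma trans_exp_one_param u : one_param (trans_exp u).
Proof.
move=> s t; apply: sim_inj; rewrite val_simM /=; congr (_, _, _).
- by rewrite mulr1.
- by rewrite mulmx1.
by rewrite mul1mx scale1r -scalerDl addrC.
Qed.

Lemma screw_exp_one_param a p : a * p = 0 -> one_param (screw_exp a p).
Proof.
move=> ap s t; apply: sim_inj; rewrite val_simM /=; congr (_, _, _).
- by rewrite mulrDr expRD.
- exact: rotD.
rewrite rot_vec3 vec3Z vec3D !mulr0 !addr0 mulr0; congr (vec3 _ _ _).
move: ap => /eqP; rewrite mulf_eq0 => /orP[] /eqP ->; last by rewrite !mul0r mulr0 addr0.
by rewrite mul0r expR0; ring.
Qed.

Lemma hom_exp_tangent w : tangent (hom_exp w) (1, 0, w).
Proof.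
split; first by apply: sim_inj; rewrite /= expR0 subrr scale0r.
have de := is_derive_expR (0 : R).
split => /= [|i j|i].
- by apply: is_derive_eq de _; rewrite expR0.
- have -> : (0 : 'M[R]_3) i j = 0 by rewrite mxE.
  exact: is_derive_cst.
under eq_fun do rewrite mxE.
have H := is_deriveM (is_deriveB de (is_derive_cst (1 : R) _ _)) (is_derive_cst (w i 0) (0 : R) (1 : R)).
by apply: is_derive_eq H _; rewrite expR0 /GRing.scale /= subr0; ring.
Qed.

Lemma trans_exp_tangent u : tangent (trans_exp u) (0, 0, u).
Proof.
split; first by apply: sim_inj; rewrite /= scale0r.
split => /= [|i j|i].
- exact: is_derive_cst.
- have -> : (0 : 'M[R]_3) i j = 0 by rewrite mxE.
  exact: is_derive_cst.
under eq_fun do rewrite mxE.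
have H := is_deriveM (is_derive_id (0 : R) (1 : R)) (is_derive_cst (u i 0) (0 : R) (1 : R)).
by apply: is_derive_eq H _; rewrite /GRing.scale /= ; ring.
Qed.

Lemma screw_exp_tangent a p : tangent (screw_exp a p) (tvec a 0 0 1 0 0 p).
Proof.
split; first by apply: sim_inj; rewrite /= !mulr0 expR0 rot0 vec30.
have dl (c : R) : is_derive (0 : R) (1 : R) (fun t => c * t) c.
  by apply: is_derive_eq (is_deriveZ c (is_derive_id _ _)) _; rewrite /GRing.scale /= mulr1.
split => /= [|i j|i].
- have de : is_derive (a * 0) (1 : R) (@expR R) 1.
    by apply: is_derive_eq (is_derive_expR _) _; rewrite mulr0 expR0.
  by apply: is_derive_eq (is_derive1_comp de (dl a)) _; rewrite mul1r.
- under eq_fun do rewrite mxE.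
  have ds := is_derive_sin (0 : R); have dc := is_derive_cos (0 : R).
  rewrite mxE; elim/ord3_ind: i; elim/ord3_ind: j => /=; rewrite ?oppr0; try exact: is_derive_cst.
  + by apply: is_derive_eq dc _; rewrite sin0 oppr0.
  + by apply: is_derive_eq ds _; rewrite cos0.
  + by apply: is_derive_eq (is_deriveN ds) _; rewrite cos0.
  by apply: is_derive_eq dc _; rewrite sin0 oppr0.
under eq_fun do rewrite mxE.
by rewrite mxE; elim/ord3_ind: i => /=; [exact: is_derive_cst|exact: is_derive_cst|exact: dl].
Qed.

End Coordinates.

Section CoordinatesLiePair.
Context {R : realType}.
Local Notation V := (R * 'M[R]_3 * 'cV[R]_3)%type.
Implicit Types (X Y : V) (a p q r t x y z c : R).

Lemma Ad_tvec_trans (h : sim R) u1 u2 u3 a x y z p q r :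
  val h = (1, 1%:M, vec3 u1 u2 u3) ->
  Ad h (tvec a x y z p q r) = tvec a x y z (p - (a * u1 + z * u2 - y * u3))
    (q - (a * u2 + x * u3 - z * u1)) (r - (a * u3 + y * u1 - x * u2)).
Proof.
move=> eh; rewrite /Ad eh /= trmx1 mulmx1 !mul1mx scale1r sk_vec3.
by congr (_, _, _) => /=; apply: cv3P; rewrite !mxE /=; split; ring.
Qed.

Lemma Ad_tvec_scale (h : sim R) c a x y z p q r : val h = (c, 1%:M, 0) ->
  Ad h (tvec a x y z p q r) = tvec a x y z (c * p) (c * q) (c * r).
Proof.
move=> eh; rewrite /Ad eh /= trmx1 mulmx1 !mul1mx scaler0 mulmx0 !subr0.
by rewrite vec3Z.
Qed.

Lemma Ad_tvec_hom (h : sim R) c u1 u2 u3 a x y z p q r :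
  val h = (c, 1%:M, vec3 u1 u2 u3) ->
  Ad h (tvec a x y z p q r) = tvec a x y z (c * p - (a * u1 + z * u2 - y * u3))
    (c * q - (a * u2 + x * u3 - z * u1)) (c * r - (a * u3 + y * u1 - x * u2)).
Proof.
move=> eh; rewrite /Ad eh /= trmx1 mulmx1 !mul1mx sk_vec3.
by congr (_, _, _) => /=; apply: cv3P; rewrite !mxE /=; split; ring.
Qed.

Lemma Ad_tvec_rot (h : sim R) c t u a x y z p q r (x' := cos t * x + sin t * y)
    (y' := - sin t * x + cos t * y) :
  val h = (c, rot t, vec3 0 0 u) ->
  Ad h (tvec a x y z p q r) = tvec a x' y' z
    (c * (cos t * p + sin t * q) + y' * u) (c * (- sin t * p + cos t * q) - x' * u)
    (c * r - a * u).
Proof.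
move=> eh; rewrite /Ad eh /= rot_sk rot_vec3 sk_vec3.
by congr (_, _, _) => /=; apply: cv3P; rewrite !mxE /= -/x' -/y'; split; ring.
Qed.

Variables (G : set (sim R)) (g : set V).
Hypothesis GP : lie_pair G g.

Lemma lp_coord X : g X -> exists a x y z p q r, X = tvec a x y z p q r.
Proof.
move=> /(lp_skew GP) /sk_eta; case: X => [[a A] v] /= ->; rewrite (vec3_eta v).
by do 7!eexists.
Qed.

Lemma lp_comb a b X Y : g X -> g Y -> g (a *: X + b *: Y).
Proof. by move=> gX gY; apply: (lp_addr GP); apply: (lp_scale GP). Qed.

Lemma lp_homG p q r t : g (tvec 1 0 0 0 p q r) -> G (hom_exp (vec3 p q r) t).
Proof.
move=> gX; apply: (lp_exp GP t gX); first exact: hom_exp_one_param.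
by rewrite /tvec sk0; exact: hom_exp_tangent.
Qed.

Lemma lp_transG p q r t : g (tvec 0 0 0 0 p q r) -> G (trans_exp (vec3 p q r) t).
Proof.
move=> gX; apply: (lp_exp GP t gX); first exact: trans_exp_one_param.
by rewrite /tvec sk0; exact: trans_exp_tangent.
Qed.

Lemma lp_screwG a p t : a * p = 0 -> g (tvec a 0 0 1 0 0 p) -> G (screw_exp a p t).
Proof.
move=> ap gX; apply: (lp_exp GP t gX); first exact: screw_exp_one_param.
exact: screw_exp_tangent.
Qed.

(* The homothety of ratio 2 centred at the fixed point gives the exact bracket,
   without a limit: [Ad h X - X = [U, X]]. *)
Lemma lp_hom_bracket u1 u2 u3 a x y z p q r :
  g (tvec 1 0 0 0 u1 u2 u3) -> g (tvec a x y z p q r) ->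
  g (tvec 0 0 0 0 (p - (a * u1 + z * u2 - y * u3)) (q - (a * u2 + x * u3 - z * u1))
    (r - (a * u3 + y * u1 - x * u2))).
Proof.
move=> gU gX; have GU := lp_homG (ln 2) gU.
have eU : val (hom_exp (vec3 u1 u2 u3) (ln 2)) = (2, 1%:M, vec3 u1 u2 u3).
  rewrite /= lnK; last by rewrite posrE.
  by rewrite -[X in X *: _](_ : 1 = _) ?scale1r //; ring.
have := lp_comb 1 (-1) (lp_Ad GP GU gX) gX.
rewrite (Ad_tvec_hom _ _ _ _ _ _ _ eU) !tvecZ tvecD.
by congr (g _); congr tvec; ring.
Qed.

(** Conjugation by a translation is affine in its vector, so time 1 already gives the exact bracket:
    the linear part [a + sk x y z] applied to the vector [u]. *)
Lemma lp_trans_bracket u1 u2 u3 a x y z p q r :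
  g (tvec 0 0 0 0 u1 u2 u3) -> g (tvec a x y z p q r) ->
  g (tvec 0 0 0 0 (a * u1 + z * u2 - y * u3) (a * u2 + x * u3 - z * u1)
    (a * u3 + y * u1 - x * u2)).
Proof.
move=> gU gX; have GU := lp_transG 1 gU.
have eU : val (trans_exp (vec3 u1 u2 u3) 1) = (1, 1%:M, vec3 u1 u2 u3).
  by rewrite /= scale1r.
have := lp_comb (-1) 1 (lp_Ad GP GU gX) gX.
rewrite (Ad_tvec_trans _ _ _ _ _ _ _ eU) !tvecZ tvecD.
by congr (g _); congr tvec; ring.
Qed.

(** Here no single difference is the bracket; the formula is used at the times [pi] and [pi / 2],
    where the rotation permutes the horizontal coordinates up to sign. *)
Lemma lp_screw_Ad b u t a x y z p q r (x' := cos t * x + sin t * y)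
    (y' := - sin t * x + cos t * y) : b * u = 0 ->
  g (tvec b 0 0 1 0 0 u) -> g (tvec a x y z p q r) ->
  g (tvec a x' y' z
    (expR (b * t) * (cos t * p + sin t * q) + y' * (u * t))
    (expR (b * t) * (- sin t * p + cos t * q) - x' * (u * t))
    (expR (b * t) * r - a * (u * t))).
Proof.
move=> bu gU gX; have GU := lp_screwG t bu gU.
have := lp_Ad GP GU gX.
by rewrite (@Ad_tvec_rot (screw_exp b u t) (expR (b * t)) t (u * t)).
Qed.

End CoordinatesLiePair.

(** * Functions that are constant on the group *)

Section Invariants.
Context {R : realType}.
Local Notation V := (R * 'M[R]_3 * 'cV[R]_3)%type.
Implicit Types (X Y : V) (x : sim R).
Variables (G : set (sim R)) (g : set V).
Hypothesis GP : lie_pair G g.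

Lemma inv_scale : (forall X, g X -> X.1.1 = 0) -> forall x, G x -> (val x).1.1 = 1.
Proof.
move=> h x Gx; apply: (lp_cst GP (u := fun x => (val x).1.1)) Gx => y N X Gy gX dN.
have [dv _ _] := velocity_left y dN.2.
by apply: is_derive_eq dv _; rewrite /= (h X gX) mulr0.
Qed.

(** Along [y * N s] the column [j] has velocity the linear part of [y] applied to the column [j] of
    [X.1.2]. *)
Lemma inv_linear_col j : (forall X i, g X -> X.1.2 i j = 0) ->
  forall x i, G x -> (val x).1.2 i j = (i == j)%:R.
Proof.
move=> h x i Gx; apply: etrans (lp_cst GP (u := fun x => (val x).1.2 i j) _ Gx) _ => //=; last first.
  by rewrite mxE.
move=> y N X Gy gX dN.
have [_ dv _] := velocity_left y dN.2.
by apply: is_derive_eq (dv i j) _; rewrite /= mxE big1 // => k _; rewrite (h X) // mulr0.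
Qed.

Lemma inv_linear : (forall X, g X -> X.1.2 = 0) -> forall x, G x -> (val x).1.2 = 1%:M.
Proof.
move=> h x Gx; apply/matrixP => i j; rewrite mxE.
by apply: inv_linear_col => // X k /h ->; rewrite mxE.
Qed.

Lemma inv_trans i : (forall x X, G x -> g X -> ((val x).1.2 *m X.2) i 0 = 0) ->
  forall x, G x -> (val x).2 i 0 = 0.
Proof.
move=> h x Gx; apply: etrans (lp_cst GP (u := fun x => (val x).2 i 0) _ Gx) _ => //=; last first.
  by rewrite mxE.
move=> y N X Gy gX dN.
have [_ _ dv] := velocity_left y dN.2.
by apply: is_derive_eq (dv i) _; rewrite /= mxE (h y X) // mulr0.
Qed.

(* With [th] moving along [G] like the angle of the rotation, the scalar product of
   the first row of the linear part with [(cos th, sin th)] is constant. *)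
Lemma inv_angle (th : sim R -> R) : th 1%g = 0 ->
  (forall x N X, G x -> g X -> tangent N X ->
     is_derive (0 : R) (1 : R) (fun s => th (x * N s)%g) (X.1.2 0 1)) ->
  (forall X, g X -> X.1.2 2 0 = 0 /\ X.1.2 2 1 = 0) ->
  forall x, G x ->
    (val x).1.2 0 0 * cos (th x) + (val x).1.2 0 1 * sin (th x) = 1.
Proof.
move=> th1 dth h x Gx.
apply: etrans (lp_cst GP (u := fun x => (val x).1.2 0 0 * cos (th x) + (val x).1.2 0 1 * sin (th x)) _ Gx) _ => //=; last first.
  by rewrite th1 sin0 cos0 !mxE /= mulr0 addr0 mulr1.
move=> y N X Gy gX dN.
have [_ dv _] := velocity_left y dN.2.
have dt := dth y N X Gy gX dN.
have N1 : N 0 = 1%g by case: dN.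
have dc := is_derive1_comp (is_derive_cos (th (y * N 0)%g)) dt.
have ds := is_derive1_comp (is_derive_sin (th (y * N 0)%g)) dt.
have H := is_deriveD (is_deriveM (dv 0 0) dc) (is_deriveM (dv 0 1) ds).
apply: is_derive_eq H _; rewrite /GRing.scale /= N1 mulg1.
have [X20 X21] := h X gX.
have sX := lp_skew GP gX.
have Xd i : X.1.2 i i = 0.
  have := congr1 (fun A : 'M[R]_3 => A i i) sX; rewrite !mxE => /eqP.
  by rewrite -addr_eq0 -mulr2n mulrn_eq0 => /eqP.
have X10 : X.1.2 1 0 = - X.1.2 0 1.
  by have := congr1 (fun A : 'M[R]_3 => A 0 1) sX; rewrite !mxE.
rewrite !mxE !sum_ord3 !Xd X20 X21 X10.
have one i j : (val (1%g : sim R)).1.2 i j = (i == j)%:R by rewrite val_sim1 mxE.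
by rewrite !one /=; ring.
Qed.

End Invariants.

(** * Rotations and alignment of vectors *)

Section Rotations.
Context {R : realType}.
Implicit Types (A : 'M[R]_3) (t : R).

Lemma orth_entries A : A *m A^T = 1%:M ->
  forall i j, A i 0 * A j 0 + A i 1 * A j 1 + A i 2 * A j 2 = (i == j)%:R.
Proof.
by move=> AA i j; have /matrixP/(_ i j) := AA; rewrite !mxE sum_ord3 !mxE.
Qed.

(** The last row has norm 1 and last entry 1, so its other entries vanish; then
    [(A00 - A11)^2 + (A01 + A10)^2] is the sum of two squared row norms minus twice the determinant,
    that is 1 + 1 - 2. *)
Lemma fix_e3_entries A : A *m A^T = 1%:M -> \det A = 1 ->
    (forall i, A i 2 = (i == 2)%:R) ->
  [/\ A 1 0 = - A 0 1, A 1 1 = A 0 0, A 2 0 = 0, A 2 1 = 0 & A 0 0 ^+ 2 + A 0 1 ^+ 2 = 1].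
Proof.
move=> /orth_entries AA dA A2; have A02 := A2 0; have A12 := A2 1; have A22 := A2 2.
move: A02 A12 A22 (AA 0 0) (AA 1 1) (AA 2 2) dA; rewrite det_mx33 /= => -> -> -> e0 e1 e2.
have h : A 2 0 ^+ 2 + A 2 1 ^+ 2 = 0 by move: e2; rewrite mulr1 !expr2; lra.
move: h => /eqP; rewrite paddr_eq0 ?sqr_ge0 // !sqrf_eq0 => /andP[/eqP A20 /eqP A21].
rewrite A20 A21 => d.
have h : (A 0 0 - A 1 1) ^+ 2 + (A 0 1 + A 1 0) ^+ 2 = 0.
  by rewrite !expr2; lra.
move: h => /eqP; rewrite paddr_eq0 ?sqr_ge0 // !sqrf_eq0 subr_eq0 addr_eq0.
move=> /andP[/eqP A00 /eqP A01].
split => //; first by rewrite A01 opprK.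
by rewrite !expr2; lra.
Qed.

(** Two unit vectors of scalar product 1 are equal. The angle is therefore specified by a single
    scalar equation, which an invariant function can provide. *)
Lemma fix_e3_rot A t : A *m A^T = 1%:M -> \det A = 1 ->
  (forall i, A i 2 = (i == 2)%:R) -> A 0 0 * cos t + A 0 1 * sin t = 1 -> A = rot t.
Proof.
move=> AA dA A2 h; have [A10 A11 A20 A21 cs] := fix_e3_entries AA dA A2.
have e : cos t ^+ 2 + sin t ^+ 2 = 1 := cos2Dsin2 t.
have : (A 0 0 - cos t) ^+ 2 + (A 0 1 - sin t) ^+ 2 = 0.
  by move: cs e h; rewrite !expr2; lra.
move=> /eqP; rewrite paddr_eq0 ?sqr_ge0 // !sqrf_eq0 !subr_eq0 => /andP[/eqP h0 /eqP h1].
apply/matrixP => i j; elim/ord3_ind: i; elim/ord3_ind: j;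
  by rewrite !mxE /= ?A2 ?A10 ?A11 ?A20 ?A21 ?h0 ?h1.
Qed.

Lemma exists_angle (c s : R) : c ^+ 2 + s ^+ 2 = 1 -> exists t, c * cos t + s * sin t = 1.
Proof.
move=> cs; have c1 : -1 <= c <= 1.
  have : c * c <= 1 by move: (sqr_ge0 s) cs; rewrite !expr2; lra.
  by move=> h; apply/andP; split; nra.
have hc := acosK c1; have hs := sin_acos c1.
have hs2 : Num.sqrt (1 - c ^+ 2) = `|s| by rewrite -sqrtr_sqr; congr Num.sqrt; lra.
rewrite hs2 in hs.
have [s0|s0] := leP 0 s.
  by exists (acos c); rewrite hc hs ger0_norm // -!expr2.
by exists (- acos c); rewrite cosN sinN hc hs ltr0_norm // opprK -!expr2.
Qed.

Lemma fix_e3_exists_rot A : A *m A^T = 1%:M -> \det A = 1 ->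
  (forall i, A i 2 = (i == 2)%:R) -> exists t, A = rot t.
Proof.
move=> AA dA A2; have [_ _ _ _ /exists_angle[t ht]] := fix_e3_entries AA dA A2.
by exists t; exact: fix_e3_rot.
Qed.

(** The Householder reflection along [u - |u| e_3], or the identity when this vector vanishes. A
    reflection is admissible since conjugation by all of O(3) is allowed. *)
Lemma exists_align (u : 'cV[R]_3) : u != 0 ->
  exists2 H : 'M[R]_3, H *m H^T = 1%:M & exists2 c, c != 0 & H *m u = vec3 0 0 c.
Proof.
move=> u0; pose s := u 0 0 ^+ 2 + u 1 0 ^+ 2 + u 2 0 ^+ 2.
have s0 : 0 < s.
  rewrite lt0r !addr_ge0 ?sqr_ge0 // andbT; apply: contra u0 => /eqP s0; apply/eqP.
  have := sqr_ge0 (u 0 0); have := sqr_ge0 (u 1 0); have := sqr_ge0 (u 2 0).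
  move=> h2 h1 h0; apply: cv3P; rewrite !mxE.
  by split; apply/eqP; rewrite -sqrf_eq0; apply/eqP; rewrite /s in s0; lra.
pose c := Num.sqrt s; have c0 : 0 < c by rewrite sqrtr_gt0.
have c2 : c ^+ 2 = s by rewrite sqr_sqrtr // ltW.
pose n := u - vec3 0 0 c.
pose nn := n 0 0 ^+ 2 + n 1 0 ^+ 2 + n 2 0 ^+ 2.
have nT : n^T *m n = nn%:M.
  rewrite [LHS]mx11_scalar; congr (_%:M); rewrite /nn mxE sum_ord3 !(mxE trmx_key).
  by rewrite !expr2.
(* As [u] and [|u| e_3] have the same norm, the scalar product of [n] and [u] is half of that of [n]
   with itself. *)
have nu : n^T *m u = (nn / 2)%:M.
  rewrite [LHS]mx11_scalar; congr (_%:M); rewrite !mxE sum_ord3 /nn !mxE /=.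
  by move: c2; rewrite /s !expr2; lra.
have [n0|n0] := eqVneq n 0.
  exists 1%:M; first by rewrite trmx1 mulmx1.
  exists c; first by rewrite gt_eqF.
  by rewrite mul1mx; apply/eqP; rewrite -subr_eq0; apply/eqP.
have nn0 : nn != 0.
  apply: contra n0 => /eqP e; apply/eqP.
  have := sqr_ge0 (n 0 0); have := sqr_ge0 (n 1 0); have := sqr_ge0 (n 2 0).
  move=> h2 h1 h0; apply: cv3P.
  have z i : (0 : 'cV[R]_3) i 0 = 0 by rewrite mxE.
  rewrite !z.
  by split; apply/eqP; rewrite -sqrf_eq0; apply/eqP; rewrite /nn in e; lra.
pose P := n *m n^T; pose H := 1%:M - (2 / nn) *: P.
have PT : P^T = P by rewrite trmx_mul trmxK.
have PP : P *m P = nn *: P.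
  by rewrite /P mulmxA -(mulmxA n) nT mul_mx_scalar -scalemxAl.
have HT : H^T = H by rewrite linearB /= linearZ /= PT trmx1.
exists H.
  rewrite HT /H mulmxBl mul1mx mulmxBr mulmx1 -scalemxAl -scalemxAr PP !scalerA.
  have -> : 2 / nn * (2 / nn) * nn = 2 / nn + 2 / nn by field.
  by rewrite scalerDl; set Q := _ *: P; rewrite (opprD Q Q) (addrA Q) subrr sub0r opprK subrK.
exists c; first by rewrite gt_eqF.
rewrite /H mulmxBl mul1mx -scalemxAl -mulmxA nu mul_mx_scalar scalerA.
have -> : 2 / nn * (nn / 2) = 1 by field.
by rewrite scale1r opprB addrC subrK.
Qed.

(** In odd dimension [A - 1 = A (1 - A)^T] has a determinant equal to its opposite, so [A] fixes a
    nonzero vector; aligning this vector with [e_3] turns [A] into a rotation fixing [e_3]. *)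
Lemma SO3_axis A : A *m A^T = 1%:M -> \det A = 1 ->
  exists2 H : 'M[R]_3, H *m H^T = 1%:M & exists t, A = H *m rot t *m H^T.
Proof.
move=> AA dA.
have : \det (A - 1%:M) = 0.
  have : \det (A - 1%:M) = - \det (A - 1%:M).
    have e : A - 1%:M = A *m (1%:M - A)^T.
      by rewrite linearB /= trmx1 mulmxBr mulmx1 AA.
    rewrite {1}e det_mulmx dA mul1r det_tr -opprB -scaleN1r detZ.
    by rewrite -signr_odd /= expr1 mulN1r.
  by move=> /eqP; rewrite -addr_eq0 -mulr2n mulrn_eq0 => /eqP.
move=> /eqP /det0P[v v0 /eqP].
rewrite mulmxBr mulmx1 subr_eq0 => /eqP vA.
have u0 : v^T != 0 by apply: contra v0 => /eqP e; rewrite -[v]trmxK e trmx0.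
have Au : A *m v^T = v^T by rewrite -{1}vA trmx_mul mulmxA AA mul1mx.
have [H HH [c c0 Hu]] := exists_align u0.
have HH' : H^T *m H = 1%:M by exact: mulmx1C.
exists H^T; first by rewrite trmxK.
pose B := H *m A *m H^T.
have BB : B *m B^T = 1%:M.
  by rewrite !trmx_mul trmxK /B !mulmxA -(mulmxA _ H^T) HH' mulmx1 -(mulmxA _ A) AA mulmx1.
have dB : \det B = 1 by rewrite !det_mulmx dA mulr1 -det_mulmx HH det1.
have Be : B *m vec3 0 0 c = vec3 0 0 c.
  by rewrite -Hu /B -!mulmxA (mulmxA H^T) HH' mul1mx Au.
have [|t Bt] := fix_e3_exists_rot BB dB.
  move=> i; have /matrixP/(_ i 0) := Be; rewrite !mxE sum_ord3 !mxE /= !mulr0 !add0r.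
  elim/ord3_ind: i => /=.
  - by move=> /eqP; rewrite mulf_eq0 (negbTE c0) orbF => /eqP.
  - by move=> /eqP; rewrite mulf_eq0 (negbTE c0) orbF => /eqP.
  by move=> /(canRL (mulfK c0)); rewrite divff.
exists t; rewrite -Bt trmxK /B !mulmxA HH' mul1mx -mulmxA HH' mulmx1 //.
Qed.

End Rotations.

(** * Recognising the standard groups *)

Section Generated.
Context {R : realType}.
Local Notation V := (R * 'M[R]_3 * 'cV[R]_3)%type.
Implicit Types (G A B : set (sim R)) (x y h : sim R) (T : 'cV[R]_3 -> Prop).

Lemma subgroupM G x y : is_subgroup G -> G x -> G y -> G (x * y)%g.
Proof.
move=> [G1 GB] Gx Gy; rewrite -(invgK y); apply: (GB) => //.
by rewrite -[y^-1%g]mul1g; exact: GB.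
Qed.

Lemma sub_generated A x : A x -> generated A x.
Proof. by move=> Ax H [_ /(_ x Ax)]. Qed.

Lemma generated_group A : is_subgroup (generated A).
Proof.
split=> [H [[]//]|x y Ax Ay H HA].
by have [[_ HB] _] := HA; apply: HB; [exact: Ax|exact: Ay].
Qed.

Lemma generated_min A G : is_subgroup G -> A `<=` G -> generated A `<=` G.
Proof. by move=> GG AG x; apply. Qed.

Lemma generatedS A B : A `<=` B -> generated A `<=` generated B.
Proof.
move=> AB; apply: generated_min; first exact: generated_group.
by move=> x /AB; exact: sub_generated.
Qed.

(** A common form of the three standard groups of translations, so that one argument identifies all
    the semi-direct products. *)
Definition translations_by T : set (sim R) :=
  [set x | exists2 v, T v & val x = (1, 1%:M, v)].

Lemma translationsE : translations = translations_by (fun=> True).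
Proof. by apply/seteqP; split => x [v]; [exists v|move=> _ ?; exists v]. Qed.

Lemma plane_translationsE : plane_translations = translations_by (fun v => v 2 0 = 0).
Proof.
have e s t : s *: basis_vec 0 + t *: basis_vec 1 = vec3 s t 0 :> 'cV[R]_3.
  by apply: cv3P; rewrite !mxE /= !(mulr0, mulr1, addr0, add0r).
apply/seteqP; split => x.
  by move=> [s [t]]; rewrite e; exists (vec3 s t 0); rewrite ?mxE.
move=> [v v2 ex]; exists (v 0 0), (v 1 0); rewrite e ex.
by rewrite {1}(vec3_eta v) v2.
Qed.

Lemma line_translationsE :
  line_translations = translations_by (fun v => v 0 0 = 0 /\ v 1 0 = 0).
Proof.
have e t : t *: basis_vec 2 = vec3 0 0 t :> 'cV[R]_3.
  by apply: cv3P; rewrite !mxE /= !(mulr0, mulr1).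
apply/seteqP; split => x.
  by move=> [t]; rewrite e; exists (vec3 0 0 t); rewrite ?mxE.
move=> [v [v0 v1] ex]; exists (v 2 0); rewrite e ex.
by rewrite {1}(vec3_eta v) v0 v1.
Qed.

Definition linear_part x : sim R := mksim 0 (sim_scale_neq0 x) (sim_orthor x).

(** Every similarity is a translation times its linear part, so the two factors can be located
    separately. *)
Lemma eq_generated_translations G A T : is_subgroup G -> A `<=` G ->
  translations_by T `<=` G ->
  (forall x, G x -> T (val x).2 /\ generated A (linear_part x)) ->
  G = generated (A `|` translations_by T).
Proof.
move=> GG AG TG h; apply/seteqP; split; last first.
  by apply: generated_min => // x [/AG|/TG].
move=> x Gx; have [Tx Ax] := h x Gx.
have -> : x = (trans_exp (val x).2 1 * linear_part x)%g.
  apply: sim_inj; rewrite val_simM /= !mul1r !mul1mx scaler0 add0r scale1r.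
  by case: (val x) => [[]].
apply: (subgroupM (generated_group _)).
  by apply: sub_generated; right; exists (val x).2 => //=; rewrite scale1r.
by apply: generatedS Ax => y; left.
Qed.

Lemma linear_part_id x : (val x).2 = 0 -> linear_part x = x.
Proof.
move=> x0; apply: sim_inj; rewrite /= -{}x0 /=.
by case: (sim_val x) => [[]].
Qed.

Lemma eq_generated_linear G A : is_subgroup G -> A `<=` G ->
  (forall x, G x -> (val x).2 = 0 /\ generated A (linear_part x)) -> G = generated A.
Proof.
move=> GG AG h; apply/seteqP; split; last exact: generated_min.
by move=> x Gx; have [/linear_part_id {2}<-] := h x Gx.
Qed.

Lemma linear_part_scale_rot x A :
  A (mksim 0 (sim_scale_neq0 x) (@id_orth R)) ->
  A (mksim 0 (oner_neq0 R) (sim_orthor x)) ->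
  generated A (linear_part x).
Proof.
move=> A1 A2.
have -> : linear_part x = (mksim 0 (sim_scale_neq0 x) (@id_orth R) *
  mksim 0 (oner_neq0 R) (sim_orthor x))%g.
  apply: sim_inj; rewrite val_simM /= mulr1 mul1mx mul1mx scaler0 addr0 //.
by apply: (subgroupM (generated_group _)); exact: sub_generated.
Qed.

End Generated.

(** * Standard groups contained in the group, and bounds on its translation parts *)

Section Standard.
Context {R : realType}.
Local Notation V := (R * 'M[R]_3 * 'cV[R]_3)%type.
Implicit Types (T : 'cV[R]_3 -> Prop) (x : sim R) (X : V).
Variables (G : set (sim R)) (g : set V).
Hypothesis GP : lie_pair G g.
Definition has_translations T : Prop :=
  translations_by T `<=` G /\ forall x, G x -> T (val x).2.

Lemma translations_by_sub T : (forall v, T v -> g (0, 0, v)) -> translations_by T `<=` G.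
Proof.
move=> h x [v /h gv ex].
have := lp_exp GP 1 gv (trans_exp_one_param v) (trans_exp_tangent v).
by have -> // : trans_exp v 1 = x by apply: sim_inj; rewrite ex /= scale1r.
Qed.

Lemma pos_homotheties_sub : g (tvec 1 0 0 0 0 0 0) -> pos_homotheties `<=` G.
Proof.
move=> gX x [a a0 ex]; have := lp_homG GP (ln a) gX.
have -> // : hom_exp (vec3 0 0 0) (ln a) = x.
by apply: sim_inj; rewrite ex /= vec30 scaler0 lnK.
Qed.

Lemma SO2_sub : g (tvec 0 0 0 1 0 0 0) -> SO2 `<=` G.
Proof.
move=> gX x [t ex]; have := lp_screwG GP t (mulr0 0) gX.
have -> // : screw_exp 0 0 t = x.
by apply: sim_inj; rewrite ex /= !mul0r expR0 vec30.
Qed.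

Lemma spiral_sub a : g (tvec a 0 0 1 0 0 0) -> spiral a `<=` G.
Proof.
move=> gX x [t ex]; have := lp_screwG GP t (mulr0 a) gX.
have -> // : screw_exp a 0 t = x.
by apply: sim_inj; rewrite ex /= mul0r vec30.
Qed.

Lemma screw_sub : g (tvec 0 0 0 1 0 0 1) -> screw `<=` G.
Proof.
move=> gX x [t ex]; have := lp_screwG GP t (mul0r 1) gX.
have -> // : screw_exp 0 1 t = x.
apply: sim_inj; rewrite ex /= mul0r mul1r expR0; congr (_, _, _).
by apply: cv3P; rewrite !mxE /= !(mulr0, mulr1).
Qed.

(** A rotation lies on the one-parameter group of rotations about its axis, whose velocity is
    skew-symmetric and hence in [g]. *)
Lemma SO3_sub : (forall x y z : R, g (tvec 0 x y z 0 0 0)) -> SO3 `<=` G.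
Proof.
move=> gX s [A [AA dA] es]; have [H HH [t At]] := SO3_axis AA dA.
pose h := mksim 0 (oner_neq0 R) HH.
have ds := tangent_conj h (screw_exp_tangent (0 : R) 0).
have gY : g (Ad h (tvec 0 0 0 1 0 0 0)).
  rewrite /Ad /= vec30 !mulmx0 !scaler0 !subr0.
  have sY : (H *m sk 0 0 1 *m H^T)^T = - (H *m sk 0 0 1 *m H^T).
    rewrite !trmx_mul trmxK mulmxA -mulNmx -mulmxN; congr (_ *m _ *m _).
    by apply/matrixP => i j; elim/ord3_ind: i; elim/ord3_ind: j; rewrite !mxE /=; ring.
  by rewrite (sk_eta sY) -vec30; exact: gX.
have := lp_exp GP t gY _ ds.
have -> : (h * screw_exp 0 0 t * h^-1)%g = s.
  apply: sim_inj; rewrite es At !val_simM val_simV /= !mul0r expR0 vec30.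
  by rewrite !(mulr1, invr1, mulmx0, scaler0, addr0, oppr0).
apply; move=> u w.
by rewrite (screw_exp_one_param (mulr0 0)) !mulgA mulgVK.
Qed.

(** All infinitesimal rotations have axis direction [e_3]. The linear parts of [g] then kill [e_3],
    so those of [G] fix it. *)
Definition axial : Prop := forall X, g X -> exists a z v, X = (a, sk 0 0 z, v).

Lemma axial_col : axial -> forall x i, G x -> (val x).1.2 i 2 = (i == 2)%:R.
Proof.
move=> h; apply: (inv_linear_col GP) => X i /h[a [z [v ->]]] /=.
by elim/ord3_ind: i; rewrite mxE /= ?oppr0.
Qed.

Lemma axial_entries : axial -> forall x, G x ->
  [/\ (val x).1.2 1 0 = - (val x).1.2 0 1, (val x).1.2 1 1 = (val x).1.2 0 0,
      (val x).1.2 2 0 = 0, (val x).1.2 2 1 = 0 &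
      (val x).1.2 0 0 ^+ 2 + (val x).1.2 0 1 ^+ 2 = 1].
Proof.
move=> ax x Gx; apply: fix_e3_entries; first exact: sim_orthor.
  exact: (lp_det GP).
by move=> i; exact: axial_col.
Qed.

Lemma axial_rot : axial -> forall x, G x -> exists t, (val x).1.2 = rot t.
Proof.
move=> ax x Gx; apply: fix_e3_exists_rot; first exact: sim_orthor.
  exact: (lp_det GP).
by move=> i; exact: axial_col.
Qed.

Lemma axial_angle (th : sim R -> R) : axial -> th 1%g = 0 ->
  (forall x N X, G x -> g X -> tangent N X ->
     is_derive (0 : R) (1 : R) (fun s => th (x * N s)%g) (X.1.2 0 1)) ->
  forall x, G x -> (val x).1.2 = rot (th x).
Proof.
move=> ax th1 dth x Gx; apply: fix_e3_rot; first exact: sim_orthor.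
- exact: (lp_det GP).
- by move=> i; exact: axial_col.
apply: (inv_angle GP th1 dth) => // X /ax[a [z [v ->]]] /=.
by rewrite !mxE /= oppr0.
Qed.

Lemma has_translations_all : (forall v : 'cV[R]_3, g (0, 0, v)) -> has_translations (fun=> True).
Proof. by move=> h; split => //; apply: translations_by_sub. Qed.

(** The linear parts of [G] preserve the horizontal plane, so the velocity of the height is a
    multiple of [X.2 2 0]. *)
Lemma has_translations_plane : axial -> (forall v : 'cV[R]_3, v 2 0 = 0 -> g (0, 0, v)) ->
  (forall X, g X -> X.2 2 0 = 0) -> has_translations (fun v => v 2 0 = 0).
Proof.
move=> ax h h'; split; first exact: translations_by_sub.
apply: (inv_trans GP) => x X Gx gX.
have [_ _ A20 A21 _] := axial_entries ax Gx.
by rewrite mxE sum_ord3 A20 A21 h' // mulr0 !mul0r !addr0.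
Qed.

Lemma has_translations_line : axial ->
  (forall v : 'cV[R]_3, v 0 0 = 0 /\ v 1 0 = 0 -> g (0, 0, v)) ->
  (forall X, g X -> X.2 0 0 = 0 /\ X.2 1 0 = 0) ->
  has_translations (fun v => v 0 0 = 0 /\ v 1 0 = 0).
Proof.
move=> ax h h'; split; first exact: translations_by_sub.
move=> x Gx; split; apply: (inv_trans GP) x Gx => x X Gx gX; have [X0 X1] := h' X gX;
by rewrite mxE sum_ord3 X0 X1 axial_col //= !mulr0 mul0r !addr0.
Qed.

Lemma no_translations : (forall X, g X -> X.2 = 0) -> forall x, G x -> (val x).2 = 0.
Proof.
move=> h x Gx; apply/matrixP => i j; rewrite ord1 [RHS]mxE.
by apply: (inv_trans GP) Gx => y X Gy /h ->; rewrite mulmx0 mxE.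
Qed.

End Standard.

Section LinearParts.
Context {R : realType}.
Local Notation V := (R * 'M[R]_3 * 'cV[R]_3)%type.
Implicit Types (T : 'cV[R]_3 -> Prop) (x : sim R) (X : V) (a : R).
Variables (G : set (sim R)) (g : set V).
Hypothesis GP : lie_pair G g.

Lemma linear_part_hom : (forall X, g X -> X.1.2 = 0) ->
  forall x, G x -> pos_homotheties (linear_part x).
Proof.
move=> h x Gx; exists (val x).1.1; first exact: (lp_gt0 GP).
by rewrite /= (inv_linear GP h).
Qed.

Lemma linear_part_rot : axial g -> (forall X, g X -> X.1.1 = 0) ->
  forall x, G x -> SO2 (linear_part x).
Proof.
move=> ax h x Gx; have [t et] := axial_rot GP ax Gx.
by exists t; rewrite /= et (inv_scale GP h).
Qed.

Lemma linear_part_hom_rot : axial g ->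
  forall x, G x -> generated (pos_homotheties `|` SO2) (linear_part x).
Proof.
move=> ax x Gx; have [t et] := axial_rot GP ax Gx.
apply: linear_part_scale_rot.
  by left; exists (val x).1.1 => //; exact: (lp_gt0 GP).
by right; exists t; rewrite /= et.
Qed.

Lemma linear_part_SO3 : (forall X, g X -> X.1.1 = 0) ->
  forall x, G x -> SO3 (linear_part x).
Proof.
move=> h x Gx; exists (val x).1.2; last by rewrite /= (inv_scale GP h).
by split; [exact: sim_orthor|exact: (lp_det GP)].
Qed.

Lemma linear_part_hom_SO3 x : G x ->
  generated (pos_homotheties `|` SO3) (linear_part x).
Proof.
move=> Gx; apply: linear_part_scale_rot.
  by left; exists (val x).1.1 => //; exact: (lp_gt0 GP).
right; exists (val x).1.2 => //.
by split; [exact: sim_orthor|exact: (lp_det GP)].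
Qed.

(** The logarithm of the scale grows [a] times as fast as the angle, so divided by [a] it is a
    globally defined angle. *)
Lemma linear_part_spiral a : a != 0 -> axial g ->
  (forall X, g X -> X.1.1 = a * X.1.2 0 1) ->
  forall x, G x -> spiral a (linear_part x).
Proof.
move=> a0 ax h x Gx; exists (ln (val x).1.1 / a); rewrite /=.
rewrite mulrC divfK // lnK; last by rewrite posrE; exact: (lp_gt0 GP).
congr (_, _, _); apply: (axial_angle GP (th := fun x => ln (val x).1.1 / a)) Gx => //=.
  by rewrite ln1 mul0r.
move=> {}x N X Gx gX dN; have [N0 _] := dN.
have [dv _ _] := velocity_left x dN.2.
have x0 : 0 < (val (x * N 0)%g).1.1 by rewrite N0 mulg1; exact: (lp_gt0 GP).
have dl := @is_derive1_comp R (@ln R) (fun s => (val (x * N s)%g).1.1) 0 _ _ (is_derive1_ln x0) dv.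
have := is_deriveM dl (is_derive_cst a^-1 (0 : R) (1 : R)) => H.
apply: is_derive_eq H _.
rewrite /GRing.scale /= N0 /= mulr1 (h X gX) mulr0 add0r.
have x1 := sim_scale_neq0 x.
by rewrite (mulKf x1) (mulKf a0).
Qed.

(** Here the height serves as the angle; splitting off the horizontal translation leaves a screw
    motion. *)
Lemma screw_decomposition : axial g -> (forall X, g X -> X.1.1 = 0) ->
  (forall X, g X -> X.2 2 0 = X.1.2 0 1) ->
  forall x, G x -> generated (screw `|` plane_translations) x.
Proof.
move=> ax h0 h x Gx.
have a1 := inv_scale GP h0 Gx.
have rx : (val x).1.2 = rot ((val x).2 2 0).
  apply: (axial_angle GP (th := fun x => (val x).2 2 0)) Gx => //=; first by rewrite mxE.
  move=> y N X Gy gX dN.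
  have [_ _ dv] := velocity_left y dN.2.
  apply: is_derive_eq (dv 2) _; rewrite /= (inv_scale GP h0 Gy) scale1r mxE sum_ord3.
  have [_ _ -> -> _] := axial_entries GP ax Gy.
  by rewrite (axial_col GP ax 2 Gy) eqxx h // !mul0r !add0r mul1r.
move: rx; have := vec3_eta (val x).2.
move: ((val x).2 0 0) ((val x).2 1 0) ((val x).2 2 0) => p q r ev rx.
have -> : x = (mksim (vec3 p q 0) (oner_neq0 R) (@id_orth R) *
    mksim (vec3 0 0 r) (oner_neq0 R) (rot_orth r))%g.
  apply: sim_inj; rewrite val_simM /= mulr1 !mul1mx scale1r vec3D !add0r addr0.
  by rewrite -rx -a1 -ev -[LHS]/(val x); case: (val x) => [[]].
apply: (@subgroupM _ (generated (screw `|` plane_translations)) _ _ (generated_group _));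
  apply: sub_generated.
  right; rewrite plane_translationsE; exists (vec3 p q 0) => //.
  by rewrite mxE.
left; exists r; rewrite /=; congr (_, _, _).
by apply: cv3P; rewrite !mxE /= !(mulr0, mulr1).
Qed.

End LinearParts.

Section Classified.
Context {R : realType}.
Local Notation V := (R * 'M[R]_3 * 'cV[R]_3)%type.
Implicit Types (G K : set (sim R)) (h x : sim R).

Definition standard (a : R) K : Prop :=
     K = generated (pos_homotheties `|` translations) \/
     K = generated (pos_homotheties `|` SO3 `|` translations) \/
     K = generated (SO3 `|` translations) \/
     K = generated (spiral a `|` translations) \/
     K = translations \/
     K = generated (SO2 `|` translations) \/
     K = generated (pos_homotheties `|` SO2 `|` translations) \/
     K = generated (screw `|` plane_translations) \/
     K = generated (SO2 `|` plane_translations) \/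
     K = generated (pos_homotheties `|` SO2 `|` plane_translations) \/
     K = generated (pos_homotheties `|` plane_translations) \/
     K = generated (spiral a `|` plane_translations) \/
     K = plane_translations \/
     K = generated (SO2 `|` line_translations) \/
     K = generated (pos_homotheties `|` SO2 `|` line_translations) \/
     K = generated (spiral a `|` line_translations) \/
     K = generated (pos_homotheties `|` line_translations) \/
     K = generated (pos_homotheties `|` SO3) \/
     K = SO3 \/
     K = generated (pos_homotheties `|` SO2).

Definition classified G : Prop :=
  exists (a : R) K, a != 0 /\ conjugate_to G K /\ standard a K.

Lemma classified_standard a G : a != 0 -> standard a G -> classified G.
Proof.
move=> a0 sG; exists a, G; split => //; split => //; exists 1%g.
by apply/seteqP; split => [x Gx|_ [x Gx <-]]; [exists x => //|]; rewrite conjg1.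
Qed.

Lemma classified_conj h G : classified (conj_set h G) -> classified G.
Proof.
move=> [a [K [a0 [[u eK] sK]]]]; exists a, K; split => //; split => //.
(* [x ^ g] stands for [g^-1 * x * g], whereas [conj_set h] uses [h * x * h^-1]; hence the inverse on
   [h]. *)
exists (h^-1 * u)%g; rewrite eK; apply/seteqP; split => [_ [_ [x Gx <-] <-]|_ [x Gx <-]].
  by exists x => //; rewrite !conjgE invgM invgK !mulgA.
exists (h * x * h^-1)%g; first by exists x.
by rewrite !conjgE invgM invgK !mulgA.
Qed.

End Classified.

(** * From an algebra in standard position to its group *)

Section Finish.
Context {R : realType}.
Local Notation V := (R * 'M[R]_3 * 'cV[R]_3)%type.
Implicit Types (T : 'cV[R]_3 -> Prop) (X : V) (a p q r x y z : R).
Variables (G : set (sim R)) (g : set V).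
Hypothesis GP : lie_pair G g.
Let GG := lp_group GP.

Lemma tvec_inj a x y z p q r a' x' y' z' p' q' r' :
  tvec a x y z p q r = tvec a' x' y' z' p' q' r' ->
  [/\ a = a', [/\ x = x', y = y' & z = z'] & [/\ p = p', q = q' & r = r']].
Proof.
move=> [ea eA ev].
have hA i j := congr1 (fun A : 'M[R]_3 => A i j) eA.
have hv i := congr1 (fun v : 'cV[R]_3 => v i 0) ev.
move: (hA 1 2) (hA 2 0) (hA 0 1) (hv 0) (hv 1) (hv 2).
by rewrite !mxE.
Qed.

Lemma tvec_trans (v : 'cV[R]_3) : (0, 0, v) = tvec 0 0 0 0 (v 0 0) (v 1 0) (v 2 0).
Proof. by rewrite /tvec sk0 -vec3_eta. Qed.

Lemma axialP : axial g <->
  forall a x y z p q r, g (tvec a x y z p q r) -> x = 0 /\ y = 0.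
Proof.
split=> [ax a x y z p q r /ax[b [c [v]]]|h X gX].
  by rewrite (vec3_eta v) => /tvec_inj[_ [-> ->]].
have [a [x [y [z [p [q [r eX]]]]]]] := lp_coord GP gX.
by move: gX; rewrite eX => /h[-> ->]; exists a, z, (vec3 p q r).
Qed.

Definition trans_in p q r : Prop := g (tvec 0 0 0 0 p q r).

Lemma trans_in_comb c d p q r p' q' r' : trans_in p q r -> trans_in p' q' r' ->
  trans_in (c * p + d * p') (c * q + d * q') (c * r + d * r').
Proof.
move=> h h'; have := lp_comb GP c d h h'.
by rewrite !tvecZ tvecD !mulr0 !addr0.
Qed.

Lemma trans_in_scale c p q r : trans_in p q r -> trans_in (c * p) (c * q) (c * r).
Proof. by move=> h; have := trans_in_comb c 0 h h; rewrite !mul0r !addr0. Qed.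

(** The coordinates of the result are separate equations, to be closed by [ring] or [field] once the
    coefficient is supplied. *)
Lemma trans_inZ c p q r p' q' r' : trans_in p q r ->
  c * p = p' -> c * q = q' -> c * r = r' -> trans_in p' q' r'.
Proof. by move=> h <- <- <-; exact: trans_in_scale. Qed.

Lemma trans_inC c d p q r p' q' r' p1 q1 r1 : trans_in p q r -> trans_in p' q' r' ->
  c * p + d * p' = p1 -> c * q + d * q' = q1 -> c * r + d * r' = r1 -> trans_in p1 q1 r1.
Proof. by move=> h h' <- <- <-; exact: trans_in_comb. Qed.

Lemma trans_in_all : trans_in 1 0 0 -> trans_in 0 1 0 -> trans_in 0 0 1 -> forall p q r, trans_in p q r.
Proof.
move=> h1 h2 h3 p q r; have := trans_in_comb 1 r (trans_in_comb p q h1 h2) h3.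
by rewrite !(mulr0, mulr1, mul1r, addr0, add0r).
Qed.

Lemma trans_in_plane : trans_in 1 0 0 -> trans_in 0 1 0 -> forall p q, trans_in p q 0.
Proof.
move=> h1 h2 p q; have := trans_in_comb p q h1 h2.
by rewrite !(mulr0, mulr1, mul1r, addr0, add0r).
Qed.

Lemma trans_in_line : trans_in 0 0 1 -> forall r, trans_in 0 0 r.
Proof. by move=> h r; have := trans_in_scale r h; rewrite !mulr0 mulr1. Qed.

Definition standard_translations T : Prop :=
  [\/ translations_by T = translations, translations_by T = plane_translations |
      translations_by T = line_translations].

(** When the translation part of each element is itself in [g], the translations in [g] bound the
    translation parts that occur in [G]. *)
Lemma has_standard_translations : axial g ->
  (forall a z p q r, g (tvec a 0 0 z p q r) -> trans_in p q r) ->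
  [\/ trans_in 0 0 1 /\ (forall p q r, trans_in p q r -> p = 0 /\ q = 0),
      [/\ trans_in 1 0 0, trans_in 0 1 0 & forall p q r, trans_in p q r -> r = 0] |
      [/\ trans_in 1 0 0, trans_in 0 1 0 & trans_in 0 0 1]] ->
  exists2 T, has_translations G T & standard_translations T.
Proof.
move=> ax hT.
have hX X : g X -> trans_in (X.2 0 0) (X.2 1 0) (X.2 2 0).
  move=> gX; have [a [z [v eX]]] := ax X gX.
  by move: gX; rewrite eX /= {1}(vec3_eta v) => /hT.
case=> [[h h']|[h1 h2 h']|[h1 h2 h3]].
- exists (fun v => v 0 0 = 0 /\ v 1 0 = 0); last first.
    by apply: Or33; rewrite line_translationsE.
  apply: (has_translations_line GP) => // [v [v0 v1]|X /hX /h'//].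
  by rewrite tvec_trans v0 v1; exact: trans_in_line.
- exists (fun v => v 2 0 = 0); last by apply: Or32; rewrite plane_translationsE.
  apply: (has_translations_plane GP) => // [v v2|X /hX /h'//].
  by rewrite tvec_trans v2; exact: trans_in_plane.
exists (fun=> True); last by apply: Or31; rewrite translationsE.
by apply: (has_translations_all GP) => v; rewrite tvec_trans; exact: trans_in_all.
Qed.

Lemma eq_generated_of T A : has_translations G T -> A `<=` G ->
  (forall s, G s -> generated A (linear_part s)) -> G = generated (A `|` translations_by T).
Proof.
move=> [TG hT] AG h; apply: eq_generated_translations => // x Gx.
by split; [exact: hT|exact: h].
Qed.

Lemma classified_hom_rot T : axial g -> g (tvec 1 0 0 0 0 0 0) -> g (tvec 0 0 0 1 0 0 0) ->
  has_translations G T -> standard_translations T -> classified G.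
Proof.
move=> ax gH gR hT sT.
have E : G = generated (pos_homotheties `|` SO2 `|` translations_by T).
  apply: eq_generated_of => //; last exact: (linear_part_hom_rot GP).
  by move=> x [/(pos_homotheties_sub GP gH)|/(SO2_sub GP gR)].
apply: (@classified_standard _ 1); first exact: oner_neq0.
by rewrite /standard; case: sT E => ->; tauto.
Qed.

Lemma classified_rot a T : axial g -> g (tvec a 0 0 1 0 0 0) ->
  (forall X, g X -> X.1.1 = a * X.1.2 0 1) ->
  has_translations G T -> standard_translations T -> classified G.
Proof.
move=> ax gX h hT sT; have [a0|a0] := eqVneq a 0.
  move: gX h; rewrite a0 => gX h.
  have E : G = generated (SO2 `|` translations_by T).
    apply: eq_generated_of => //; first exact: (SO2_sub GP gX).
    move=> x Gx; apply: sub_generated; apply: (linear_part_rot GP) => // X /h ->.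
    by rewrite mul0r.
  apply: (@classified_standard _ 1); first exact: oner_neq0.
  by rewrite /standard; case: sT E => ->; tauto.
have E : G = generated (spiral a `|` translations_by T).
  apply: eq_generated_of => //; first exact: (spiral_sub GP gX).
  by move=> x Gx; apply: sub_generated; exact: (linear_part_spiral GP).
apply: (classified_standard a0).
by rewrite /standard; case: sT E => ->; tauto.
Qed.

Lemma classified_screw : axial g -> g (tvec 0 0 0 1 0 0 1) -> trans_in 1 0 0 -> trans_in 0 1 0 ->
  (forall X, g X -> X.1.1 = 0) -> (forall X, g X -> X.2 2 0 = X.1.2 0 1) ->
  classified G.
Proof.
move=> ax gX h1 h2 h0 h.
have E : G = generated (screw `|` plane_translations).
  apply/seteqP; split; first by move=> x; exact: (screw_decomposition GP).
  apply: generated_min => // x [/(screw_sub GP gX)//|].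
  rewrite plane_translationsE; apply: (translations_by_sub GP) => v v2.
  by rewrite tvec_trans v2; exact: trans_in_plane.
apply: (@classified_standard _ 1); first exact: oner_neq0.
by rewrite /standard; tauto.
Qed.

Lemma classified_SO3_all : (forall x y z p q r, g (tvec 0 x y z p q r)) -> classified G.
Proof.
move=> h.
have hT : has_translations G (fun=> True).
  by apply: (has_translations_all GP) => v; rewrite tvec_trans; exact: h.
have sG : SO3 `<=` G by apply: (SO3_sub GP) => x y z; exact: h.
apply: (@classified_standard _ 1); first exact: oner_neq0.
rewrite /standard translationsE.
have [h0|] := pselect (forall X, g X -> X.1.1 = 0).
  have E : G = generated (SO3 `|` translations_by (fun=> True)).
    apply: eq_generated_of => // x Gx.
    by apply: sub_generated; exact: (linear_part_SO3 GP).
  by tauto.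
move=> /existsNP[X /not_implyP[gX /eqP X0]].
have gH : g (tvec 1 0 0 0 0 0 0).
  have [a [x [y [z [p [q [r eX]]]]]]] := lp_coord GP gX.
  move: gX X0; rewrite eX /= => gX a0.
  have := lp_comb GP a^-1 (- a^-1) gX (h x y z p q r).
  by rewrite !tvecZ tvecD; congr (g _); congr tvec; rewrite ?mulVf // ?mulr0 ?addr0 // mulNr addrN.
have E : G = generated (pos_homotheties `|` SO3 `|` translations_by (fun=> True)).
  apply: eq_generated_of => //; last exact: (linear_part_hom_SO3 GP).
  by move=> x [/(pos_homotheties_sub GP gH)|/sG].
by tauto.
Qed.

Lemma classified_SO3_0 : (forall x y z, g (tvec 0 x y z 0 0 0)) ->
  (forall X, g X -> X.2 = 0) -> classified G.
Proof.
move=> h hT; have hG := no_translations GP hT.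
have sG : SO3 `<=` G by exact: (SO3_sub GP).
apply: (@classified_standard _ 1); first exact: oner_neq0.
rewrite /standard.
have [h0|] := pselect (forall X, g X -> X.1.1 = 0).
  have E : G = SO3.
    apply/seteqP; split => // x Gx.
    by rewrite -(linear_part_id (hG x Gx)); exact: (linear_part_SO3 GP).
  by tauto.
move=> /existsNP[X /not_implyP[gX /eqP X0]].
have gH : g (tvec 1 0 0 0 0 0 0).
  have [a [x [y [z [p [q [r eX]]]]]]] := lp_coord GP gX.
  have := hT X gX; rewrite eX /= -vec30 => ev.
  move: gX X0; rewrite eX /tvec ev /= => gX a0.
  have := lp_comb GP a^-1 (- a^-1) gX (h x y z).
  by rewrite !tvecZ tvecD; congr (g _); congr tvec; rewrite ?mulVf // ?mulr0 ?addr0 // mulNr addrN.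
have E : G = generated (pos_homotheties `|` SO3).
  apply: eq_generated_linear => //; first by move=> x [/(pos_homotheties_sub GP gH)|/sG].
  by move=> x Gx; split; [exact: hG|exact: (linear_part_hom_SO3 GP)].
by tauto.
Qed.

Lemma classified_hom_rot_0 : axial g -> g (tvec 1 0 0 0 0 0 0) -> g (tvec 0 0 0 1 0 0 0) ->
  (forall X, g X -> X.2 = 0) -> classified G.
Proof.
move=> ax gH gR hT.
have E : G = generated (pos_homotheties `|` SO2).
  apply: eq_generated_linear => //.
    by move=> x [/(pos_homotheties_sub GP gH)|/(SO2_sub GP gR)].
  by move=> x Gx; split; [exact: (no_translations GP hT)|exact: (linear_part_hom_rot GP)].
apply: (@classified_standard _ 1); first exact: oner_neq0.
by rewrite /standard; tauto.
Qed.

(** Without homotheties, the translations along a line would form a group of dimension one, which is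
    not in the list; hence the exclusion. *)
Lemma classified_flat T : (forall X, g X -> X.1.2 = 0) ->
  g (tvec 1 0 0 0 0 0 0) \/ (forall X, g X -> X.1.1 = 0) /\ translations_by T <> line_translations ->
  has_translations G T -> standard_translations T -> classified G.
Proof.
move=> hA hH hT sT.
apply: (@classified_standard _ 1); first exact: oner_neq0.
case: hH => [gH|[h0 nT]].
  have E : G = generated (pos_homotheties `|` translations_by T).
    apply: eq_generated_of => //; first exact: (pos_homotheties_sub GP).
    by move=> x Gx; apply: sub_generated; exact: (linear_part_hom GP).
  by rewrite /standard; case: sT E => ->; tauto.
have E : G = translations_by T.
  have [TG hGT] := hT; apply/seteqP; split => // x Gx; exists (val x).2; first exact: hGT.
  have := inv_linear GP hA Gx; have := inv_scale GP h0 Gx.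
  by case: (val x) => [[a A] v] /= -> ->.
by rewrite /standard; case: sT E nT => ->; tauto.
Qed.

End Finish.

(** * Classification of the Lie algebras *)

Section Axial.
Context {R : realType}.
Local Notation V := (R * 'M[R]_3 * 'cV[R]_3)%type.
Implicit Types (G : set (sim R)) (g : set V) (X : V) (a b c p q r x y z u : R).

Definition sim_trans u1 u2 u3 : sim R := mksim (vec3 u1 u2 u3) (oner_neq0 R) (@id_orth R).
Definition sim_scale c (c0 : c != 0) : sim R := mksim 0 c0 (@id_orth R).

Lemma Ad_sim_trans u1 u2 u3 a x y z p q r :
  Ad (sim_trans u1 u2 u3) (tvec a x y z p q r) =
  tvec a x y z (p - (a * u1 + z * u2 - y * u3))
    (q - (a * u2 + x * u3 - z * u1)) (r - (a * u3 + y * u1 - x * u2)).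
Proof. exact: Ad_tvec_trans. Qed.

Lemma Ad_sim_scale c (c0 : c != 0) a x y z p q r :
  Ad (sim_scale c0) (tvec a x y z p q r) = tvec a x y z (c * p) (c * q) (c * r).
Proof. exact: Ad_tvec_scale. Qed.

(** This is the form in which dimension at least 2 rules out the degenerate cases. *)
Lemma lp_not_line G g X : lie_pair G g -> ~ (forall Y, g Y -> exists c, Y = c *: X).
Proof.
move=> GP h; have [Y [Z [gY gZ YZ]]] := lp_indep GP.
have [c eY] := h Y gY; have [d eZ] := h Z gZ.
have [|d0 /eqP] := YZ d (- c).
  by rewrite eY eZ !scalerA mulNr mulrC scaleNr addrN.
rewrite oppr_eq0 => /eqP c0.
have [|/eqP] := YZ 1 0; last by rewrite oner_eq0.
by rewrite eY c0 !scale0r scaler0 addr0.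
Qed.

(** The bracket of a translation with the given element, minus its dilation part, is [(q, - p, 0)].
    Applied twice, this separates horizontal from vertical parts, and a nonzero horizontal vector
    spans the plane together with its quarter turn. *)
Lemma axial_translation_kinds G g a p0 q0 r0 : lie_pair G g -> g (tvec a 0 0 1 p0 q0 r0) ->
  (forall p q r, trans_in g p q r -> [/\ p = 0, q = 0 & r = 0]) \/
  [\/ trans_in g 0 0 1 /\ (forall p q r, trans_in g p q r -> p = 0 /\ q = 0),
      [/\ trans_in g 1 0 0, trans_in g 0 1 0 & forall p q r, trans_in g p q r -> r = 0] |
      [/\ trans_in g 1 0 0, trans_in g 0 1 0 & trans_in g 0 0 1]].
Proof.
move=> GP gX.
have hJ p q r : trans_in g p q r -> trans_in g q (- p) 0.
  move=> h; have h' := lp_trans_bracket GP h gX.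
  by apply: (trans_inC (c := 1) (d := - a) GP h' h); ring.
have hz p q r : trans_in g p q r -> trans_in g p q 0 /\ trans_in g 0 0 r.
  move=> h; have h' := hJ _ _ _ (hJ _ _ _ h); split.
    by apply: (trans_inZ (c := -1) GP h'); ring.
  by apply: (trans_inC (c := 1) (d := 1) GP h h'); ring.
have h3 : trans_in g 0 0 1 \/ (forall p q r, trans_in g p q r -> r = 0).
  have [|/existsNP[p /existsNP[q /existsNP[r /not_implyP[h /eqP r0']]]]] :=
    pselect (forall p q r, trans_in g p q r -> r = 0); first by right.
  left; have [_ h'] := hz _ _ _ h.
  by apply: (trans_inZ (c := r^-1) GP h'); rewrite ?mulr0 ?mulVf.
have h12 : (trans_in g 1 0 0 /\ trans_in g 0 1 0) \/ (forall p q r, trans_in g p q r -> p = 0 /\ q = 0).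
  have [|/existsNP[p /existsNP[q /existsNP[r /not_implyP[h pq]]]]] :=
    pselect (forall p q r, trans_in g p q r -> p = 0 /\ q = 0); first by right.
  left; have [h' _] := hz _ _ _ h; have h'' := hJ _ _ _ h'.
  have s0 : p ^+ 2 + q ^+ 2 != 0.
    apply/eqP => /eqP; rewrite paddr_eq0 ?sqr_ge0 // !sqrf_eq0 => /andP[/eqP p0' /eqP q0'].
    exact: pq.
  split.
    by apply: (trans_inC (c := p / (p ^+ 2 + q ^+ 2)) (d := q / (p ^+ 2 + q ^+ 2)) GP h' h''); field.
  by apply: (trans_inC (c := q / (p ^+ 2 + q ^+ 2)) (d := - p / (p ^+ 2 + q ^+ 2)) GP h' h''); field.
case: h3 h12 => [h3|h3] [[h1 h2]|h12].
- by right; apply: Or33.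
- by right; apply: Or31.
- by right; apply: Or32.
by left => p q r h; have [-> ->] := h12 _ _ _ h; rewrite (h3 _ _ _ h).
Qed.

(** The bracket with a homothety centred at the origin sends an element of [g] to its translation
    part, which is thus in [g]. *)
Lemma classified_axial_hom0 G g a p q r : lie_pair G g -> axial g ->
  g (tvec 1 0 0 0 0 0 0) -> g (tvec a 0 0 1 p q r) -> classified G.
Proof.
move=> GP ax gH gX.
have hz b x y z p' q' r' : g (tvec b x y z p' q' r') -> trans_in g p' q' r'.
  by move=> h; have := lp_hom_bracket GP gH h; rewrite /trans_in; congr (g _); congr tvec; ring.
have gR : g (tvec 0 0 0 1 0 0 0).
  have := lp_comb GP 1 (-1) (lp_comb GP 1 (- a) gX gH) (hz _ _ _ _ _ _ _ gX).
  by rewrite !(tvecZ, tvecD); congr (g _); congr tvec; ring.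
have [h0|hk] := axial_translation_kinds GP gX.
  apply: (classified_hom_rot_0 GP ax gH gR) => X gX'.
  have [b [x [y [z [p' [q' [r' eX]]]]]]] := lp_coord GP gX'.
  by move: gX'; rewrite eX => /hz /h0[-> -> ->]; rewrite /= vec30.
have hT b z p' q' r' : g (tvec b 0 0 z p' q' r') -> trans_in g p' q' r' by exact: hz.
have [T hasT sT] := has_standard_translations GP ax hT hk.
exact: (classified_hom_rot GP ax gH gR hasT sT).
Qed.

Lemma axial_conj G g h : lie_pair G g -> axial g -> (val h).1.2 = 1%:M -> axial (Ad_set h g).
Proof.
move=> GP ax h1 _ [X /ax[a [z [v ->]]] <-].
rewrite /Ad h1 trmx1 mulmx1 mul1mx /=; by do 3!eexists.
Qed.

(** Subtracting [z] times the given element leaves no rotation, hence no dilation by the hypothesis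
    on rotation-free elements. *)
Lemma axial_kernel G g a p : lie_pair G g -> axial g -> g (tvec a 0 0 1 0 0 p) ->
  (forall b p q r, g (tvec b 0 0 0 p q r) -> b = 0) ->
  forall b z p' q' r', g (tvec b 0 0 z p' q' r') ->
  b = a * z /\ trans_in g p' q' (r' - z * p).
Proof.
move=> GP ax gX hk b z p' q' r' gY.
have := lp_comb GP 1 (- z) gY gX; rewrite !tvecZ tvecD => h.
have e0 : 1 * b + - z * a = 0.
  apply: (hk _ p' q' (r' - z * p)); move: h; congr (g _); congr tvec; ring.
split; first by apply/eqP; rewrite -subr_eq0; apply/eqP; rewrite -e0; ring.
by move: h; rewrite e0 /trans_in; congr (g _); congr tvec; ring.
Qed.

Lemma classified_axial G g a p : lie_pair G g -> axial g -> a * p = 0 ->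
  g (tvec a 0 0 1 0 0 p) -> classified G.
Proof.
move=> GP ax ap gX.
have [hk|] := pselect (forall b p q r, g (tvec b 0 0 0 p q r) -> b = 0); last first.
  move=> /existsNP[b /existsNP[p1 /existsNP[q1 /existsNP[r1 /not_implyP[gY /eqP b0]]]]].
  have gH : g (tvec 1 0 0 0 (b^-1 * p1) (b^-1 * q1) (b^-1 * r1)).
    by have := lp_scale GP b^-1 gY; rewrite tvecZ mulVf // mulr0.
  (* The fixed point of this infinitesimal homothety is opposite to its translation part, so [h]
     moves it to the origin. *)
  pose h := sim_trans (b^-1 * p1) (b^-1 * q1) (b^-1 * r1).
  have GP' := lie_pair_conj h GP.
  apply: (@classified_conj _ h).
  have ax' : axial (Ad_set h g) by apply: (axial_conj GP).
  have gH' : Ad_set h g (tvec 1 0 0 0 0 0 0).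
    exists (tvec 1 0 0 0 (b^-1 * p1) (b^-1 * q1) (b^-1 * r1)) => //.
    by rewrite Ad_sim_trans; congr tvec; ring.
  have gX' : Ad_set h g (Ad h (tvec a 0 0 1 0 0 p)) by exists (tvec a 0 0 1 0 0 p).
  by rewrite Ad_sim_trans in gX'; exact: (classified_axial_hom0 GP' ax' gH' gX').
have ker := axial_kernel GP ax gX hk.
have ha X : g X -> X.1.1 = a * X.1.2 0 1.
  move=> gY; have [b [z [v eX]]] := ax X gY; move: gY.
  by rewrite eX (vec3_eta v) => /ker[] /= -> _; rewrite mxE.
have [h0|hk'] := axial_translation_kinds GP gX.
  (* Without translations, [g] would be spanned by the given element. *)
  exfalso; apply: (lp_not_line (X := tvec a 0 0 1 0 0 p) GP) => Y gY.
  have [b [z [v eY]]] := ax Y gY; move: gY; rewrite eY (vec3_eta v) => /ker[-> /h0[-> -> e]].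
  exists z; rewrite tvecZ; congr tvec; try ring.
  by apply/eqP; rewrite -subr_eq0; apply/eqP.
have [e3|[h1 h2 h3]] : trans_in g 0 0 1 \/
    [/\ trans_in g 1 0 0, trans_in g 0 1 0 & forall p q r, trans_in g p q r -> r = 0].
  by case: hk' => [[h _]|[h1 h2 h3]|[_ _ h]]; [left|right|left].
  (* The vertical translations absorb the pitch. *)
  have gX0 : g (tvec a 0 0 1 0 0 0).
    have := lp_comb GP 1 (- p) gX e3; rewrite !tvecZ tvecD; congr (g _); congr tvec; ring.
  have hT b z p' q' r' : g (tvec b 0 0 z p' q' r') -> trans_in g p' q' r'.
    by move=> /ker[_ h]; apply: (trans_inC (c := 1) (d := z * p) GP h e3); ring.
  have [T hasT sT] := has_standard_translations GP ax hT hk'.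
  exact: (classified_rot GP ax gX0 ha hasT sT).
have [p0|p0] := eqVneq p 0.
  rewrite p0 in gX ker.
  have hT b z p' q' r' : g (tvec b 0 0 z p' q' r') -> trans_in g p' q' r'.
    by move=> /ker[_]; rewrite mulr0 subr0.
  have [T hasT sT] := has_standard_translations GP ax hT hk'.
  exact: (classified_rot GP ax gX ha hasT sT).
have a0 : a = 0 by move: ap => /eqP; rewrite mulf_eq0 (negbTE p0) orbF => /eqP.
have ip0 : p^-1 != 0 by rewrite invr_neq0.
(* The pitch cannot be removed here; a homothety of ratio [p^-1] normalises it to 1. *)
pose h := sim_scale ip0.
have GP' := lie_pair_conj h GP.
apply: (@classified_conj _ h).
have hm X : g X -> Ad_set h g (Ad h X) by move=> gX'; exists X.
apply: (classified_screw GP').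
- by apply: (axial_conj GP).
- have := hm _ gX; rewrite Ad_sim_scale a0; congr (Ad_set _ _ _); congr tvec; rewrite ?mulr0 //.
  by rewrite mulVf.
- apply: (trans_inZ (c := p) GP' (p := p^-1) (q := 0) (r := 0)); rewrite ?mulr0 ?divff //.
  by have := hm _ h1; rewrite Ad_sim_scale /trans_in !mulr0 mulr1.
- apply: (trans_inZ (c := p) GP' (p := 0) (q := p^-1) (r := 0)); rewrite ?mulr0 ?divff //.
  by have := hm _ h2; rewrite Ad_sim_scale /trans_in !mulr0 mulr1.
- by move=> _ [X gY <-] /=; rewrite (ha X gY) a0 mul0r.
move=> _ [X gY <-].
have [b [z [v eX]]] := ax X gY; move: gY; rewrite eX (vec3_eta v) => /ker[_ /h3 e].
rewrite -/(tvec b 0 0 z _ _ _) Ad_sim_scale /= !mxE /=.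
have -> : v 2 0 = z * p by apply/eqP; rewrite -subr_eq0; apply/eqP.
by rewrite mulrCA mulVf // mulr1.
Qed.

End Axial.

(** * Rotations about several axes, and reduction to the axis of a rotation *)

Section NonAxial.
Context {R : realType}.
Local Notation V := (R * 'M[R]_3 * 'cV[R]_3)%type.
Implicit Types (G : set (sim R)) (g : set V) (X : V) (a b c p q r x y z u : R).

(** A cyclic permutation of the axes, through which results on rotations about [e_3] apply to the
    other axes. *)
Definition cyc_mx : 'M[R]_3 := \matrix_(i, j)
  nth 0 (nth [::] [:: [:: 0; 1; 0]; [:: 0; 0; 1]; [:: 1; 0; 0]] i) j.

Lemma cyc_orth : cyc_mx *m cyc_mx^T = 1%:M.
Proof.
apply/matrixP => i j; elim/ord3_ind: i; elim/ord3_ind: j;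
  rewrite !mxE ?sum_ord3 !mxE /=; ring.
Qed.

Definition sim_linear (H : 'M[R]_3) (HH : H *m H^T = 1%:M) : sim R :=
  mksim 0 (oner_neq0 R) HH.

Lemma Ad_sim_linear H (HH : H *m H^T = 1%:M) X :
  Ad (sim_linear HH) X = (X.1.1, H *m X.1.2 *m H^T, H *m X.2).
Proof. by rewrite /Ad /= mulmx0 scaler0 !subr0 scale1r. Qed.

Definition sim_cyc : sim R := sim_linear cyc_orth.

Lemma Ad_sim_cyc a x y z p q r : Ad sim_cyc (tvec a x y z p q r) = tvec a y z x q r p.
Proof.
rewrite Ad_sim_linear /=; congr (_, _, _).
  apply/matrixP => i j; elim/ord3_ind: i; elim/ord3_ind: j;
    rewrite !mxE !sum_ord3 !mxE !sum_ord3 !mxE /=; ring.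
by apply: cv3P; rewrite !mxE !sum_ord3 !mxE /=; split; ring.
Qed.

Lemma Ad_set_cyc G g a x y z p q r : lie_pair G g ->
  Ad_set sim_cyc g (tvec a y z x q r p) <-> g (tvec a x y z p q r).
Proof.
move=> GP; split => [[X gX]|gX]; last by exists (tvec a x y z p q r); rewrite ?Ad_sim_cyc.
have [a' [x' [y' [z' [p' [q' [r' eX]]]]]]] := lp_coord GP gX.
by move: gX; rewrite eX Ad_sim_cyc => gX /tvec_inj[<- [<- <- <-] [<- <- <-]].
Qed.

Lemma trans_in_Ad_set_trans G g u1 u2 u3 p q r : lie_pair G g ->
  trans_in (Ad_set (sim_trans u1 u2 u3) g) p q r -> trans_in g p q r.
Proof.
move=> GP [X gX]; have [a' [x' [y' [z' [p' [q' [r' eX]]]]]]] := lp_coord GP gX.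
move: gX; rewrite eX Ad_sim_trans => gX /tvec_inj[a0 [x0 y0 z0] [<- <- <-]].
by move: gX; rewrite a0 x0 y0 z0 /trans_in; congr (g _); congr tvec; ring.
Qed.

(* Two half-turn conjugates cancel up to a translation, which detects the pitch. *)
Lemma so3_half_turn G g p0 p q r : lie_pair G g ->
  g (tvec 0 0 0 1 0 0 p0) -> g (tvec 0 1 0 0 p q r) -> trans_in g 0 (p0 * pi) (2 * r).
Proof.
move=> GP g3 g1.
have := lp_comb GP 1 1 (lp_screw_Ad GP pi (mul0r p0) g3 g1) g1.
rewrite !(tvecZ, tvecD) cospi sinpi mul0r expR0.
by rewrite /trans_in; congr (g _); congr tvec; ring.
Qed.

Lemma so3_half_turn2 G g p0 p q r : lie_pair G g ->
  g (tvec 0 0 0 1 0 0 p0) -> g (tvec 0 0 1 0 p q r) -> trans_in g (- (p0 * pi)) 0 (2 * r).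
Proof.
move=> GP g3 g1.
have := lp_comb GP 1 1 (lp_screw_Ad GP pi (mul0r p0) g3 g1) g1.
rewrite !(tvecZ, tvecD) cospi sinpi mul0r expR0.
by rewrite /trans_in; congr (g _); congr tvec; ring.
Qed.

Lemma so3_quarter_turn G g p0 p q r : lie_pair G g ->
  g (tvec 0 0 0 1 0 0 p0) -> g (tvec 0 1 0 0 p q r) ->
  exists p' q' r', g (tvec 0 0 1 0 p' q' r').
Proof.
move=> GP g3 g1.
have := lp_scale GP (-1) (lp_screw_Ad GP (pi / 2) (mul0r p0) g3 g1).
rewrite tvecZ cos_pihalf sin_pihalf => h.
do 3!eexists; move: h; congr (g _); congr tvec; try exact: erefl; ring.
Qed.

(** Half turns force the pitch to vanish, so [g] contains all infinitesimal rotations about the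
    origin. The bracket of a homothety with them is a translation, hence 0: its centre is fixed by
    all rotations and is the origin. *)
Lemma classified_so3_no_trans G g p : lie_pair G g ->
  (forall p q r, trans_in g p q r -> [/\ p = 0, q = 0 & r = 0]) ->
  g (tvec 0 0 0 1 0 0 0) -> g (tvec 0 1 0 0 p 0 0) -> classified G.
Proof.
move=> GP T0 g3 g1.
have p0 : p = 0.
  have GP' := lie_pair_conj sim_cyc GP.
  have g3' : Ad_set sim_cyc g (tvec 0 0 0 1 0 0 p) by apply/(Ad_set_cyc _ _ _ _ _ _ _ GP).
  have g1' : Ad_set sim_cyc g (tvec 0 0 1 0 0 0 0) by apply/(Ad_set_cyc _ _ _ _ _ _ _ GP).
  have := so3_half_turn2 GP' g3' g1'.
  rewrite /trans_in => /(Ad_set_cyc _ _ _ _ _ _ _ GP) /T0[_ /eqP + _].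
  by rewrite oppr_eq0 mulf_eq0 (gt_eqF (pi_gt0 R)) orbF => /eqP.
rewrite p0 in g1.
have g2 : g (tvec 0 0 1 0 0 0 0).
  have := lp_scale GP (-1) (lp_screw_Ad GP (pi / 2) (mul0r 0) g3 g1).
  by rewrite tvecZ cos_pihalf sin_pihalf mul0r; congr (g _); congr tvec; ring.
have gso x y z : g (tvec 0 x y z 0 0 0).
  have := lp_comb GP 1 z (lp_comb GP x y g1 g2) g3.
  by rewrite !(tvecZ, tvecD); congr (g _); congr tvec; ring.
apply: (classified_SO3_0 GP gso) => X gX.
have [a [x [y [z [q1 [q2 [q3 eX]]]]]]] := lp_coord GP gX.
rewrite eX /= -vec30; move: gX; rewrite eX => gX.
have gY : g (tvec a 0 0 0 q1 q2 q3).
  have := lp_comb GP 1 (-1) gX (gso x y z).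
  by rewrite !(tvecZ, tvecD); congr (g _); congr tvec; ring.
have [a0|a0] := eqVneq a 0.
  by move: gY; rewrite a0 => /T0[-> -> ->].
have gH : g (tvec 1 0 0 0 (a^-1 * q1) (a^-1 * q2) (a^-1 * q3)).
  by have := lp_scale GP a^-1 gY; rewrite tvecZ mulVf // mulr0.
have e0 u : (a^-1 * u = 0) -> u = 0.
  by move=> /eqP; rewrite mulf_eq0 invr_eq0 (negbTE a0) => /eqP.
have [h1 h2 _] := T0 _ _ _ (lp_hom_bracket GP gH g3).
have [_ h3 _] := T0 _ _ _ (lp_hom_bracket GP gH g1).
congr vec3; apply: e0.
- by apply: etrans h2; ring.
- by apply: oppr_inj; rewrite oppr0; apply: etrans h1; ring.
by apply: oppr_inj; rewrite oppr0; apply: etrans h3; ring.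
Qed.

(** Brackets with the three generators act on translations as so(3) acts on space, which is
    irreducible; composing [J2] and [J3] isolates one coordinate. *)
Lemma so3_translations G g p1 q1 r1 p2 q2 r2 p3 q3 r3 p q r : lie_pair G g ->
  g (tvec 0 1 0 0 p1 q1 r1) -> g (tvec 0 0 1 0 p2 q2 r2) -> g (tvec 0 0 0 1 p3 q3 r3) ->
  trans_in g p q r -> ~ [/\ p = 0, q = 0 & r = 0] -> forall p q r, trans_in g p q r.
Proof.
move=> GP g1 g2 g3.
have J1 u v w : trans_in g u v w -> trans_in g 0 w (- v).
  by move=> h; have := lp_trans_bracket GP h g1; rewrite /trans_in; congr (g _); congr tvec; ring.
have J2 u v w : trans_in g u v w -> trans_in g (- w) 0 u.
  by move=> h; have := lp_trans_bracket GP h g2; rewrite /trans_in; congr (g _); congr tvec; ring.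
have J3 u v w : trans_in g u v w -> trans_in g v (- u) 0.
  by move=> h; have := lp_trans_bracket GP h g3; rewrite /trans_in; congr (g _); congr tvec; ring.
have key u v w : trans_in g u v w -> u != 0 -> forall p q r, trans_in g p q r.
  move=> h u0.
  have e3 : trans_in g 0 0 1.
    apply: (trans_inZ (c := - u^-1) GP (J2 _ _ _ (J3 _ _ _ (J3 _ _ _ h)))).
    - by rewrite oppr0 mulr0.
    - by rewrite mulr0.
    by rewrite mulrNN mulVf.
  have e2 : trans_in g 0 1 0 by have := J1 _ _ _ e3; rewrite oppr0.
  have e1 : trans_in g 1 0 0.
    by apply: (trans_inZ (c := -1) GP (J2 _ _ _ e3)); ring.
  exact: (trans_in_all GP e1 e2 e3).
move=> h n0.
have [p0|p0] := eqVneq p 0; last exact: (key _ _ _ h p0).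
have [q0|q0] := eqVneq q 0; last exact: (key _ _ _ (J3 _ _ _ h) q0).
have [r0|r0] := eqVneq r 0; first by case: n0.
by apply: (key _ _ _ (J2 _ _ _ h)); rewrite oppr_eq0.
Qed.

Lemma classified_so3 G g p0 p q r : lie_pair G g ->
  g (tvec 0 0 0 1 0 0 p0) -> g (tvec 0 1 0 0 p q r) -> classified G.
Proof.
move=> GP g3 g1.
have [p2 [q2 [r2 g2]]] := so3_quarter_turn GP g3 g1.
have [T0|] := pselect (forall p q r, trans_in g p q r -> [/\ p = 0, q = 0 & r = 0]); last first.
  move=> /existsNP[u /existsNP[v /existsNP[w /not_implyP[h n0]]]].
  have hT := so3_translations GP g1 g2 g3 h n0.
  apply: (classified_SO3_all GP) => x y z p' q' r'.
  have h1 := lp_comb GP 1 z (lp_comb GP x y g1 g2) g3.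
  have := lp_comb GP 1 1 h1 (hT (p' - (x * p + y * p2)) (q' - (x * q + y * q2))
    (r' - (x * r + y * r2 + z * p0))).
  by rewrite !(tvecZ, tvecD); congr (g _); congr tvec; ring.
have [_ p00 r0] := T0 _ _ _ (so3_half_turn GP g3 g1).
have {}p00 : p0 = 0.
  by move/eqP: p00; rewrite mulf_eq0 (gt_eqF (pi_gt0 R)) orbF => /eqP.
have {}r0 : r = 0 by lra.
(* A vertical translation fixes the generator about [e_3] and removes the component [q] of the other
   one. *)
pose h := sim_trans 0 0 q; apply: (@classified_conj _ h).
have GP' := lie_pair_conj h GP.
apply: (classified_so3_no_trans GP' (p := p)).
- by move=> u v w /(trans_in_Ad_set_trans GP); exact: T0.
- exists (tvec 0 0 0 1 0 0 p0) => //; rewrite Ad_sim_trans p00; congr tvec; ring.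
exists (tvec 0 1 0 0 p q r) => //; rewrite Ad_sim_trans r0; congr tvec; ring.
Qed.

(** A half turn about [e_3] reverses the horizontal part of the rotation vector and keeps the
    dilation and the vertical part, so half the difference has a horizontal axis and no dilation. A
    quarter turn gives a second such element, and the two span the rotations about [e_1] and [e_2]
    up to translations. *)
Lemma classified_not_axial G g a p0 b x y z p q r : lie_pair G g -> a * p0 = 0 ->
  g (tvec a 0 0 1 0 0 p0) -> g (tvec b x y z p q r) -> x ^+ 2 + y ^+ 2 != 0 -> classified G.
Proof.
move=> GP ap g3 gY s0.
have [p1 [q1 [r1 gZ]]] : exists p1 q1 r1, g (tvec 0 x y 0 p1 q1 r1).
  have := lp_comb GP (1 / 2) (- (1 / 2)) gY (lp_screw_Ad GP pi ap g3 gY).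
  rewrite !(tvecZ, tvecD) cospi sinpi => h.
  by do 3!eexists; move: h; congr (g _); congr tvec; try exact: erefl; field.
have [p2 [q2 [r2 gZ']]] : exists p2 q2 r2, g (tvec 0 y (- x) 0 p2 q2 r2).
  have := lp_screw_Ad GP (pi / 2) ap g3 gZ.
  rewrite cos_pihalf sin_pihalf => h.
  by do 3!eexists; move: h; congr (g _); congr tvec; try exact: erefl; ring.
have [u1 [v1 [w1 g1]]] : exists p1 q1 r1, g (tvec 0 1 0 0 p1 q1 r1).
  have h := lp_comb GP (x / (x ^+ 2 + y ^+ 2)) (y / (x ^+ 2 + y ^+ 2)) gZ gZ'.
  rewrite !(tvecZ, tvecD) in h.
  by do 3!eexists; move: h; congr (g _); congr tvec; try exact: erefl; field.
have [u2 [v2 [w2 g2]]] : exists p1 q1 r1, g (tvec 0 0 1 0 p1 q1 r1).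
  have h := lp_comb GP (y / (x ^+ 2 + y ^+ 2)) (- x / (x ^+ 2 + y ^+ 2)) gZ gZ'.
  rewrite !(tvecZ, tvecD) in h.
  by do 3!eexists; move: h; congr (g _); congr tvec; try exact: erefl; field.
apply: (@classified_conj _ sim_cyc); have GP' := lie_pair_conj sim_cyc GP.
have g3' := (Ad_set_cyc 0 1 0 0 u1 v1 w1 GP).2 g1.
have g1' := (Ad_set_cyc 0 0 1 0 u2 v2 w2 GP).2 g2.
(* This translation brings the axis of the generator about [e_3] through the origin, leaving only
   its pitch [u1]. *)
pose h := sim_trans (- w1) v1 0.
apply: (@classified_conj _ h); have GP'' := lie_pair_conj h GP'.
have g1'' : Ad_set h (Ad_set sim_cyc g) (Ad h (tvec 0 1 0 0 v2 w2 u2)).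
  by exists (tvec 0 1 0 0 v2 w2 u2).
rewrite Ad_sim_trans in g1''; apply: (classified_so3 (p0 := u1) GP'' _ g1'').
by exists (tvec 0 0 0 1 v1 w1 u1) => //; rewrite Ad_sim_trans; congr tvec; ring.
Qed.

Lemma classified_normal_form G g a p : lie_pair G g -> a * p = 0 ->
  g (tvec a 0 0 1 0 0 p) -> classified G.
Proof.
move=> GP ap gX.
have [ax|] := pselect (axial g); first exact: (classified_axial GP ax ap gX).
move=> nax; have : exists b x y z p q r, g (tvec b x y z p q r) /\ x ^+ 2 + y ^+ 2 != 0.
  apply: contrapT => h; apply: nax; apply/(axialP GP) => b x y z p' q' r' gY.
  have [/eqP s0|s0] := eqVneq (x ^+ 2 + y ^+ 2) 0; last first.
    by exfalso; apply: h; exists b, x, y, z, p', q', r'.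
  by move: s0; rewrite paddr_eq0 ?sqr_ge0 // !sqrf_eq0 => /andP[/eqP -> /eqP ->].
by move=> [b [x [y [z [p' [q' [r' [gY s0]]]]]]]]; exact: (classified_not_axial GP ap gX gY s0).
Qed.

(** The vector [(x, y, z)] spans the kernel of the linear part of [X]; once it is aligned with
    [e_3], only the third coordinate of the rotation survives. *)
Lemma classified_not_flat G g X : lie_pair G g -> g X -> X.1.2 != 0 -> classified G.
Proof.
move=> GP gX X0; have [a [x [y [z [p [q [r eX]]]]]]] := lp_coord GP gX.
have u0 : vec3 x y z != 0.
  apply: contra X0; rewrite -vec30 eX /= => /eqP e.
  have h i := congr1 (fun v : 'cV[R]_3 => v i 0) e.
  by move: (h 0) (h 1) (h 2); rewrite !mxE /= => -> -> ->; rewrite sk0.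
have [H HH [c c0 Hu]] := exists_align u0.
have H'H : H^T *m H = 1%:M by exact: mulmx1C.
pose h := sim_linear HH.
apply: (@classified_conj _ h); have GP' := lie_pair_conj h GP.
have gX' : Ad_set h g (Ad h X) by exists X.
have [a' [x' [y' [z' [p' [q' [r' eX']]]]]]] := lp_coord GP' gX'.
have kX : X.1.2 *m vec3 x y z = 0.
  by rewrite eX /= sk_vec3 -vec30; congr vec3; ring.
have eO : sk x' y' z' = H *m X.1.2 *m H^T.
  by move: eX'; rewrite Ad_sim_linear => -[_ ->].
have : sk x' y' z' *m vec3 0 0 c = 0.
  by rewrite eO -Hu -mulmxA (mulmxA H^T) H'H mul1mx -mulmxA kX mulmx0.
rewrite sk_vec3 -vec30 => e.
have he i := congr1 (fun v : 'cV[R]_3 => v i 0) e.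
have y'0 : y' = 0.
  have := he 0; rewrite !mxE /= mulr0 sub0r => /eqP.
  by rewrite oppr_eq0 mulf_eq0 (negbTE c0) orbF => /eqP.
have x'0 : x' = 0.
  have := he 1; rewrite !mxE /= mulr0 subr0 => /eqP.
  by rewrite mulf_eq0 (negbTE c0) orbF => /eqP.
have z'0 : z' != 0.
  apply: contra X0 => /eqP z'0; move: eO; rewrite x'0 y'0 z'0 sk0 => eO.
  apply/eqP; rewrite -[X.1.2]mul1mx -[_ *m _]mulmx1 -H'H.
  by rewrite mulmxA -(mulmxA H^T) -(mulmxA H^T) -eO mulmx0 mul0mx.
rewrite eX' x'0 y'0 in gX'.
have gY : Ad_set h g (tvec (z'^-1 * a') 0 0 1 (z'^-1 * p') (z'^-1 * q') (z'^-1 * r')).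
  by have := lp_scale GP' z'^-1 gX'; rewrite tvecZ mulVf // mulr0.
move: (z'^-1 * a') (z'^-1 * p') (z'^-1 * q') (z'^-1 * r') gY => b u v w gY.
have b1 : b ^+ 2 + 1 != 0 by rewrite gt_eqF // ltr_wpDl ?sqr_ge0.
(* The horizontal fixed point solves a system of determinant [b^2 + 1]. Vertically, [w / b] cancels
   the pitch if [b] is nonzero; for [b = 0] it is 0 by convention and the pitch stays. In both cases
   dilation times pitch is 0. *)
pose k := sim_trans ((b * u - v) / (b ^+ 2 + 1)) ((u + b * v) / (b ^+ 2 + 1)) (w / b).
apply: (@classified_conj _ k); have GP'' := lie_pair_conj k GP'.
apply: (classified_normal_form (a := b) (p := w - b * (w / b)) GP'').
  have [->|b0] := eqVneq b 0; first by rewrite mul0r.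
  by rewrite (mulrC b (w / b)) divfK // subrr mulr0.
exists (tvec b 0 0 1 u v w) => //; rewrite Ad_sim_trans; move: (w / b) => d.
by congr tvec; (ring || by field).
Qed.

End NonAxial.

(** * Algebras without rotations *)

Section Flat.
Context {R : realType}.
Local Notation V := (R * 'M[R]_3 * 'cV[R]_3)%type.
Implicit Types (G : set (sim R)) (g : set V) (X : V) (a b c p q r x y z u : R).

(** The second clause places a homothety, if [g] has any dilation, with centre at the origin; linear
    conjugations keep it there, and every element of [g] then has its translation part in [g]. *)
Definition flat g : Prop := (forall X, g X -> X.1.2 = 0) /\
  (g (tvec 1 0 0 0 0 0 0) \/ forall X, g X -> X.1.1 = 0).

Lemma flat_coord G g a x y z p q r : lie_pair G g -> flat g -> g (tvec a x y z p q r) ->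
  [/\ x = 0, y = 0, z = 0 & trans_in g p q r].
Proof.
move=> GP [hA hH] gX.
have := hA _ gX; rewrite /= -sk0 => e.
have [_ [x0 y0 z0] _] := @tvec_inj R 0 x y z 0 0 0 0 0 0 0 0 0 0 (congr1 (fun A => (0, A, vec3 0 0 0)) e).
split => //; case: hH => [gH|h0].
  by have := lp_hom_bracket GP gH gX; rewrite /trans_in; congr (g _); congr tvec; ring.
by move: gX (h0 _ gX); rewrite x0 y0 z0 /= => + a0; rewrite a0.
Qed.

Lemma flat_axial G g : lie_pair G g -> flat g -> axial g.
Proof.
move=> GP fl; apply/(axialP GP) => a x y z p q r gX.
by have [-> -> _ _] := flat_coord GP fl gX.
Qed.

Lemma classified_flat_translations G g : lie_pair G g -> flat g -> trans_in g 1 0 0 ->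
  (trans_in g 0 1 0 /\ forall p q r, trans_in g p q r -> r = 0) \/ (trans_in g 0 1 0 /\ trans_in g 0 0 1) ->
  classified G.
Proof.
move=> GP fl h1 hT.
have ax := flat_axial GP fl.
have hk a z p q r : g (tvec a 0 0 z p q r) -> trans_in g p q r by case/(flat_coord GP fl).
have [|T hasT sT] := has_standard_translations GP ax hk.
  by case: hT => [[h2 h3]|[h2 h3]]; [apply: Or32|apply: Or33].
have [_ hG] := hasT.
apply: (classified_flat GP fl.1) hasT sT; case: fl.2 => [gH|h0]; [by left|right; split => //].
(* The translation by [e_1] is in [G], which excludes the line. *)
move=> eT; have := lp_transG GP 1 h1.
move=> /hG /= Te.
have : translations_by T (trans_exp (vec3 1 0 0) 1).
  by exists (1 *: vec3 1 0 0).
rewrite eT line_translationsE => -[v [v0 _] [ev]].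
by have /eqP := congr1 (fun v : 'cV[R]_3 => v 0 0) ev; rewrite v0 !mxE /= mulr1 oner_eq0.
Qed.

Lemma flat_conj g (H : 'M[R]_3) (HH : H *m H^T = 1%:M) : flat g ->
  flat (Ad_set (sim_linear HH) g).
Proof.
move=> [hA hH]; split.
  by move=> _ [X gX <-]; rewrite Ad_sim_linear /= hA // mulmx0 mul0mx.
case: hH => [gH|h0]; [left|right].
  exists (tvec 1 0 0 0 0 0 0) => //.
  by rewrite Ad_sim_linear /= sk0 vec30 !mulmx0 mul0mx -sk0 -vec30.
by move=> _ [X gX <-] /=; exact: h0.
Qed.

Lemma trans_in_Ad_linear g (H : 'M[R]_3) (HH : H *m H^T = 1%:M) p q r :
  trans_in (Ad_set (sim_linear HH) g) p q r <-> g (0, 0, H^T *m vec3 p q r).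
Proof.
have H'H : H^T *m H = 1%:M by exact: mulmx1C.
split=> [[X gX]|gX]; last first.
  exists (0, 0, H^T *m vec3 p q r) => //.
  by rewrite Ad_sim_linear /= mulmx0 mul0mx mulmxA HH mul1mx /tvec sk0.
rewrite Ad_sim_linear /tvec sk0 => -[X0 eA <-].
rewrite mulmxA H'H mul1mx.
move: X0 eA gX; case: X => [[a A] v] /= a0 eA; rewrite a0.
have -> // : A = 0.
rewrite -[A]mul1mx -[_ *m _]mulmx1 -H'H.
by rewrite mulmxA -(mulmxA H^T) -(mulmxA H^T) eA mulmx0 mul0mx.
Qed.

Lemma dot_orth (H : 'M[R]_3) (v w : 'cV[R]_3) : H *m H^T = 1%:M ->
  (H *m v)^T *m (H *m w) = v^T *m w.
Proof.
by move=> /mulmx1C H'H; rewrite trmx_mul -mulmxA (mulmxA H^T) H'H mul1mx.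
Qed.

Lemma dot_vec3 p q r x y z : ((vec3 p q r)^T *m vec3 x y z) 0 0 = p * x + q * y + r * z.
Proof. by rewrite mxE sum_ord3 !mxE. Qed.

(* The plane containing [e_3] and [(p, q, 0)] is made horizontal. *)
Lemma classified_flat_plane G g p q : lie_pair G g -> flat g -> trans_in g 0 0 1 -> trans_in g p q 0 ->
  p ^+ 2 + q ^+ 2 != 0 -> (forall p' q' r', trans_in g p' q' r' -> p' * q = q' * p) ->
  classified G.
Proof.
move=> GP fl e3 hpq s0 hT.
have n0 : vec3 q (- p) 0 != 0.
  apply: contra s0; rewrite -vec30 => /eqP e.
  have hi i := congr1 (fun v : 'cV[R]_3 => v i 0) e.
  move: (hi 0) (hi 1); rewrite !mxE /= => -> /eqP; rewrite oppr_eq0 => /eqP ->.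
  by rewrite expr0n /= addr0.
have [H HH [c c0 Hn]] := exists_align n0.
have H'H : H^T *m H = 1%:M by exact: mulmx1C.
have GP' := lie_pair_conj (sim_linear HH) GP.
apply: (@classified_conj _ (sim_linear HH)).
(* Up to the factor [c], the height after applying [H] is the scalar product with the normal vector
   of the plane. *)
have nw (w : 'cV[R]_3) : ((vec3 q (- p) 0)^T *m w) 0 0 = c * (H *m w) 2 0.
  rewrite -(dot_orth _ _ HH) Hn; move: (H *m w) => w'.
  by rewrite [in LHS](vec3_eta w') dot_vec3 !mul0r !add0r.
have hor x y : trans_in (Ad_set (sim_linear HH) g) x y 0.
  apply/trans_in_Ad_linear.
  have : H *m (H^T *m vec3 x y 0) = vec3 x y 0 by rewrite mulmxA HH mul1mx.
  move: (H^T *m _) => w Hw; have := nw w.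
  rewrite Hw {1}(vec3_eta w) dot_vec3 [vec3 x y 0 _ _]mxE /= mul0r mulr0 addr0 => hw.
  rewrite tvec_trans.
  apply: (trans_inC (c := (w 0 0 * p + w 1 0 * q) / (p ^+ 2 + q ^+ 2)) (d := w 2 0) GP hpq e3).
  (* The horizontal part of [w] splits along [(p, q)] and along the normal, where its component
     vanishes by [hw]. *)
  - have e : w 0 0 = (w 0 0 * p + w 1 0 * q) / (p ^+ 2 + q ^+ 2) * p +
      (q * w 0 0 + - p * w 1 0) * q / (p ^+ 2 + q ^+ 2) by field.
    by rewrite [RHS]e hw; ring.
  - have e : w 1 0 = (w 0 0 * p + w 1 0 * q) / (p ^+ 2 + q ^+ 2) * q -
      (q * w 0 0 + - p * w 1 0) * p / (p ^+ 2 + q ^+ 2) by field.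
    by rewrite [RHS]e hw; ring.
  by ring.
apply: (classified_flat_translations GP' (flat_conj HH fl)); first exact: hor.
left; split; first exact: hor.
move=> x y z /trans_in_Ad_linear.
have : H *m (H^T *m vec3 x y z) = vec3 x y z by rewrite mulmxA HH mul1mx.
move: (H^T *m _) => w Hw; rewrite tvec_trans => /hT h.
have := nw w.
rewrite Hw {1}(vec3_eta w) dot_vec3 [vec3 x y z _ _]mxE /= mul0r addr0.
have -> : q * w 0 0 + - p * w 1 0 = 0 by rewrite [q * _]mulrC h; ring.
by move=> /esym/eqP; rewrite mulf_eq0 (negbTE c0) => /eqP.
Qed.

(** The translations in [g] contain the vertical line; the determinant [p' * q - q' * p] of two
    horizontal vectors tells a plane from the whole space. *)
Lemma classified_flat_e3 G g : lie_pair G g -> flat g -> trans_in g 0 0 1 -> classified G.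
Proof.
move=> GP fl e3.
have [hl|] := pselect (forall p q r, trans_in g p q r -> p = 0 /\ q = 0).
  have [gH|h0] := fl.2; last first.
    exfalso; apply: (lp_not_line (X := tvec 0 0 0 0 0 0 1) GP) => X gX.
    have [a [x [y [z [p [q [r eX]]]]]]] := lp_coord GP gX.
    have := h0 _ gX; move: gX; rewrite eX /= => gX ->.
    have [-> -> -> /hl[-> ->]] := flat_coord GP fl gX.
    by exists r; rewrite tvecZ; congr tvec; ring.
  have hk a z p q r : g (tvec a 0 0 z p q r) -> trans_in g p q r by case/(flat_coord GP fl).
  have [|T hasT sT] := has_standard_translations GP (flat_axial GP fl) hk.
    by apply: Or31.
  by apply: (classified_flat GP fl.1 _ hasT sT); left.
move=> /existsNP[p /existsNP[q /existsNP[r /not_implyP[h pq]]]].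
have hpq : trans_in g p q 0 by apply: (trans_inC (c := 1) (d := - r) GP h e3); ring.
have s0 : p ^+ 2 + q ^+ 2 != 0.
  apply/eqP => /eqP; rewrite paddr_eq0 ?sqr_ge0 // !sqrf_eq0 => /andP[/eqP p0 /eqP q0].
  exact: pq.
have [hp|] := pselect (forall p' q' r', trans_in g p' q' r' -> p' * q = q' * p).
  exact: (classified_flat_plane GP fl e3 hpq s0 hp).
move=> /existsNP[p' /existsNP[q' /existsNP[r' /not_implyP[h' /eqP d0]]]].
have h'' : trans_in g p' q' 0 by apply: (trans_inC (c := 1) (d := - r') GP h' e3); ring.
have D0 : p' * q - q' * p != 0 by rewrite subr_eq0.
have e1 : trans_in g 1 0 0.
  by apply: (trans_inC (c := - q' / (p' * q - q' * p)) (d := q / (p' * q - q' * p)) GP hpq h''); field.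
have e2 : trans_in g 0 1 0.
  by apply: (trans_inC (c := p' / (p' * q - q' * p)) (d := - p / (p' * q - q' * p)) GP hpq h''); field.
by apply: (classified_flat_translations GP fl e1); right.
Qed.

(** Without translations a flat algebra lies on the line of homotheties centred at the origin, so
    there is a translation to be aligned with [e_3]. *)
Lemma classified_flat_pair G g : lie_pair G g -> flat g -> classified G.
Proof.
move=> GP fl.
have [T0|] := pselect (forall p q r, trans_in g p q r -> [/\ p = 0, q = 0 & r = 0]).
  exfalso; apply: (lp_not_line (X := tvec 1 0 0 0 0 0 0) GP) => X gX.
  have [a [x [y [z [p [q [r eX]]]]]]] := lp_coord GP gX.
  move: gX; rewrite eX => gX.
  have [-> -> -> /T0[-> -> ->]] := flat_coord GP fl gX.
  by exists a; rewrite tvecZ; congr tvec; ring.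
move=> /existsNP[p /existsNP[q /existsNP[r /not_implyP[h n0]]]].
have u0 : vec3 p q r != 0.
  apply/eqP; rewrite -vec30 => e; apply: n0.
  have hi i := congr1 (fun v : 'cV[R]_3 => v i 0) e.
  by move: (hi 0) (hi 1) (hi 2); rewrite !mxE.
have [H HH [c c0 Hu]] := exists_align u0.
have H'H : H^T *m H = 1%:M by exact: mulmx1C.
have GP' := lie_pair_conj (sim_linear HH) GP.
apply: (@classified_conj _ (sim_linear HH)).
apply: (classified_flat_e3 GP' (flat_conj HH fl)).
have h' : trans_in (Ad_set (sim_linear HH) g) 0 0 c.
  by apply/trans_in_Ad_linear; rewrite -Hu mulmxA H'H mul1mx; move: h; rewrite /trans_in /tvec sk0.
by apply: (trans_inZ (c := c^-1) GP' h'); rewrite ?mulr0 ?mulVf.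
Qed.

Lemma lie_pair_classified G g : lie_pair G g -> classified G.
Proof.
move=> GP.
have [hA|] := pselect (forall X, g X -> X.1.2 = 0); last first.
  by move=> /existsNP[X /not_implyP[gX /eqP X0]]; exact: (classified_not_flat GP gX X0).
have [h0|] := pselect (forall X, g X -> X.1.1 = 0).
  by apply: (classified_flat_pair GP); split => //; right.
move=> /existsNP[X /not_implyP[gX /eqP X0]].
have [a [x [y [z [p [q [r eX]]]]]]] := lp_coord GP gX.
have hX := hA X gX.
have gY : g (tvec 1 0 0 0 (a^-1 * p) (a^-1 * q) (a^-1 * r)).
  have := lp_scale GP a^-1 gX; move: hX X0; rewrite eX /= => eA a0.
  have -> : tvec a x y z p q r = tvec a 0 0 0 p q r by rewrite /tvec eA sk0.
  by rewrite tvecZ mulVf // mulr0.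
(* Recentring at the fixed point of the infinitesimal homothety. *)
pose h := sim_trans (a^-1 * p) (a^-1 * q) (a^-1 * r).
have GP' := lie_pair_conj h GP.
apply: (@classified_conj _ h); apply: (classified_flat_pair GP'); split.
  by move=> _ [Y gY' <-] /=; rewrite hA // mulmx0 mul0mx.
left; exists (tvec 1 0 0 0 (a^-1 * p) (a^-1 * q) (a^-1 * r)) => //.
by rewrite Ad_sim_trans; congr tvec; ring.
Qed.

End Flat.

Theorem proposition3p3 (R : realType) (k : nat) (G : set (sim R))
    (hk : (2 <= k)%N) (hG : connected_lie_subgroup k G) :
  exists (a : R) (K : set (sim R)),
    a != 0 /\ conjugate_to G K /\
    (K = generated (pos_homotheties `|` translations) \/
     K = generated (pos_homotheties `|` SO3 `|` translations) \/
     K = generated (SO3 `|` translations) \/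
     K = generated (spiral a `|` translations) \/
     K = translations \/
     K = generated (SO2 `|` translations) \/
     K = generated (pos_homotheties `|` SO2 `|` translations) \/
     K = generated (screw `|` plane_translations) \/
     K = generated (SO2 `|` plane_translations) \/
     K = generated (pos_homotheties `|` SO2 `|` plane_translations) \/
     K = generated (pos_homotheties `|` plane_translations) \/
     K = generated (spiral a `|` plane_translations) \/
     K = plane_translations \/
     K = generated (SO2 `|` line_translations) \/
     K = generated (pos_homotheties `|` SO2 `|` line_translations) \/
     K = generated (spiral a `|` line_translations) \/
     K = generated (pos_homotheties `|` line_translations) \/
     K = generated (pos_homotheties `|` SO3) \/
     K = SO3 \/
     K = generated (pos_homotheties `|` SO2)).
Proof.
have [g GP] := connected_lie_pair hk hG.
exact: (lie_pair_classified GP).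
Qed.
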